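(* Let $M$ be a smooth $7$-dimensional manifold with a $G_2$-structure $\varphi$ with associated metric $g$ and torsion $T\in\Omega^1(\mathrm{Im}\,\mathbb{O}M)$. For a nowhere-vanishing $V\in\Gamma(\mathbb{O}M)$, consider the $G_2$-structure $\sigma_V(\varphi)$. Then the torsion $T^{(V)}$ of $\sigma_V(\varphi)$ is given by $$T^{(V)}=\mathrm{Im}\left(\mathrm{Ad}_VT+V(\nabla V^{-1})\right).$$ In particular, if $V$ has constant norm, then $$T^{(V)}=-(DV)V^{-1}.$$ (All products, $\mathrm{Ad}_V$ and $D$ are taken with respect to $\varphi$.)
   Context: Setting. A $G_2$-structure on a smooth $7$-manifold $M$ is identified with a positive $3$-form $\varphi$, i.e. one that at each point lies in the $GL(7,\mathbb{R})$-orbit of $\varphi_0=e^{123}+e^{145}+e^{167}+e^{246}-e^{257}-e^{347}-e^{356}$. It determines a unique Riemannian metric $g$ and volume form $\mathrm{vol}$ (hence an orientation) by $g(u,v)\,\mathrm{vol}=\frac16(u\lrcorner\varphi)\wedge(v\lrcorner\varphi)\wedge\varphi$, where $\lrcorner$ is contraction. Let $*$ be the Hodge star, $\psi=*\varphi$, and $\nabla$ the Levi-Civita connection of $g$. Octonion bundle. $\mathbb{O}M=\Lambda^0\oplus TM$, where $\Lambda^0$ is the trivial real line bundle; an octonion section is $A=(a,\alpha)$ with $a=\mathrm{Re}A$ a function and $\alpha=\mathrm{Im}A$ a vector field. $\bar A=(a,-\alpha)$; $\langle (a,\alpha),(b,\beta)\rangle=ab+g(\alpha,\beta)$; cross product $\langle\alpha\times\beta,\gamma\rangle=\varphi(\alpha,\beta,\gamma)$;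 octonion product $AB=(ab-\langle\alpha,\beta\rangle,\ a\beta+b\alpha+\alpha\times\beta)$; $V^{-1}=\bar V/|V|^2$; $\mathrm{Ad}_VA=VAV^{-1}$. Operations are applied to $\mathbb{O}M$-valued $1$-forms by evaluating on each vector $X$ (e.g. $(\mathrm{Ad}_VT)_X=VT_XV^{-1}$). Torsion and $D$. The torsion tensor $T_{ab}$ of a $G_2$-structure $\varphi$ is the $2$-tensor with $\nabla_a\varphi_{bcd}=2T_a{}^{e}\psi_{ebcd}$; it is viewed as the $\mathrm{Im}\,\mathbb{O}M$-valued $1$-form $X\mapsto T_X=(0,X\lrcorner T)$, with vector part $X^aT_a{}^b$. $\nabla_X(a,\alpha)=(\nabla_Xa,\nabla_X\alpha)$ and $D_XA=\nabla_XA-A\,T_X$. For a nowhere-vanishing octonion section $A=(a,\alpha)$, $\sigma_A(\varphi)=\frac{1}{|A|^2}\left((a^2-|\alpha|^2)\varphi-2a\,\alpha\lrcorner( *\varphi)+2\alpha\wedge(\alpha\lrcorner\varphi)\right)$ (with $\alpha$ in the wedge product being the dual $1$-form); it is known that this is a $G_2$-structure with the same metric and orientation as $\varphi$. Its torsion $T^{(A)}$ is defined by the same formula as for $\varphi$, using $\sigma_A(\varphi)$ and $*\sigma_A(\varphi)$. *)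

(* Defs.v *)
From HB Require Import structures.
From mathcomp Require Import all_boot all_order all_algebra all_fingroup.
From mathcomp Require Import all_classical all_reals all_analysis.
From mathcomp Require Import ring.

Set Implicit Arguments.
Unset Strict Implicit.
Unset Printing Implicit Defensive.

Import Order.TTheory GRing.Theory Num.Theory.
Import numFieldNormedType.Exports.

Local Open Scope classical_set_scope.
Local Open Scope ring_scope.

(* Tensor calculus in charts.  Coordinate vectors are row vectors, written
   u : 'rV[R]_7; a metric is a Gram matrix G, with g(u, v) = u *m G *m v^T. *)

Section LinearAlgebra.
Context {R : realType}.
Local Notation E := ('rV[R]_7).

Definition ebase (k : 'I_7) : E := delta_mx 0 k.

Definition mform (k : nat) : Type := ('I_k -> E) -> R.

Definition multilinear k (w : mform k) : Prop :=
  forall (v : 'I_k -> E) (m : 'I_k) (a : R) (x y : E),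
    w [eta v with m |-> a *: x + y] =
    a * w [eta v with m |-> x] + w [eta v with m |-> y].

Definition alternating k (w : mform k) : Prop :=
  forall (v : 'I_k -> E) (m n : 'I_k), m != n -> v m = v n -> w v = 0.

Definition vcons k (x : E) (v : 'I_k -> E) : 'I_k.+1 -> E :=
  fun m => if unlift ord0 m is Some n then v n else x.

Definition vcat k l (v : 'I_k -> E) (w : 'I_l -> E) : 'I_(k + l) -> E :=
  fun m => match fintype.split m with inl a => v a | inr b => w b end.

Definition vec3 (x y z : E) : 'I_3 -> E := fun m => nth 0 [:: x; y; z] m.

Definition contract k (x : E) (w : mform k.+1) : mform k :=
  fun v => w (vcons x v).

(* Normalised so that dx^1 /\ dx^2 = dx^1 (x) dx^2 - dx^2 (x) dx^1. *)
Definition wedge k l (a : mform k) (b : mform l) : mform (k + l) := fun v =>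
  (k`! * l`!)%:R^-1 *
  \sum_(s : 'S_(k + l)) (-1) ^+ s *
    (a (fun m => v (s (lshift l m))) * b (fun m => v (s (rshift k m)))).

Definition ip (G : 'M[R]_7) (u v : E) : R := (u *m G *m v^T) 0 0.

Definition pos_def (G : 'M[R]_7) : Prop :=
  G^T = G /\ forall u : E, u != 0 -> 0 < ip G u u.

Lemma ip_linearl (G : 'M[R]_7) a (u v w : E) :
  ip G (a *: u + v) w = a * ip G u w + ip G v w.
Proof. by rewrite /ip !mulmxDl -!scalemxAl !mxE. Qed.

Lemma ip_linearr (G : 'M[R]_7) a (u v w : E) :
  ip G w (a *: u + v) = a * ip G w u + ip G w v.
Proof. by rewrite /ip linearP /= mulmxDr -scalemxAr !mxE. Qed.

Lemma ipC (G : 'M[R]_7) (u v : E) : G^T = G -> ip G u v = ip G v u.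
Proof.
move=> sG; rewrite /ip -{1}[u *m G *m v^T]trmxK [LHS]mxE.
by rewrite !trmx_mul trmxK sG mulmxA.
Qed.

Lemma row_ebase (v : E) : v = \sum_k v 0 k *: ebase k.
Proof. by rewrite {1}[v]row_sum_delta. Qed.

Lemma ip_invmx (G : 'M[R]_7) (r v : E) : G \in unitmx ->
  ip G (r *m invmx G) v = \sum_k r 0 k * v 0 k.
Proof.
by move=> uG; rewrite /ip mulmxKV// mxE; apply: eq_bigr => k _; rewrite !mxE.
Qed.

Lemma ip_inj (G : 'M[R]_7) (u v : E) : G \in unitmx ->
  (forall w, ip G u w = ip G v w) -> u = v.
Proof.
move=> uG uv; apply: (can_inj (mulmxK uG)); apply/rowP => k.
have := uv (ebase k); rewrite /ip /ebase trmx_delta.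
by rewrite -![_ *m delta_mx _ _]colE !mxE.
Qed.

Definition flat (G : 'M[R]_7) (x : E) : mform 1 := fun v => ip G x (v ord0).

Definition volume_form (G : 'M[R]_7) (vol : mform 7) : Prop :=
  [/\ multilinear vol, alternating vol &
      forall e : 'I_7 -> E, (forall m n, ip G (e m) (e n) = (m == n)%:R) ->
        `|vol e| = 1].

(* ( *w)_{b_1..b_l} =
     1/k! g^{i_1 j_1} .. g^{i_k j_k} w_{j_1..j_k} vol_{i_1..i_k b_1..b_l},
   equivalently a /\ *w = <a, w> vol for every k-form a. *)
Definition hodge k l (G : 'M[R]_7) (vol : mform (k + l)) (w : mform k) :
    mform l := fun v =>
  (k`!)%:R^-1 *
  \sum_(I : {ffun 'I_k -> 'I_7}) \sum_(J : {ffun 'I_k -> 'I_7})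
    (\prod_(m < k) invmx G (I m) (J m)) *
    w (fun m => ebase (J m)) * vol (vcat (fun m => ebase (I m)) v).

(* dx p is e^p of the standard coframe, with indices starting at 1. *)
Definition dx (p : nat) : mform 1 := fun v => v ord0 0 (inord p.-1).

Definition dx3 (p q r : nat) : mform 3 := wedge (wedge (dx p) (dx q)) (dx r).

Definition phi0 : mform 3 := fun v =>
  dx3 1 2 3 v + dx3 1 4 5 v + dx3 1 6 7 v + dx3 2 4 6 v
  - dx3 2 5 7 v - dx3 3 4 7 v - dx3 3 5 6 v.

Definition positive_form (phi : mform 3) : Prop :=
  exists2 F : 'M[R]_7, F \in unitmx &
    forall v, phi v = phi0 (fun m => v m *m F).

(* g(u,v) vol = 1/6 (u _| phi) /\ (v _| phi) /\ phi, where vol is one of the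
   two unit volume forms of g; this determines both g and vol. *)
Definition associated_metric_at (phi : mform 3) (G : 'M[R]_7) (vol : mform 7) :
    Prop :=
  [/\ pos_def G, volume_form G vol &
      forall (u v : E) (w : 'I_7 -> E),
        ip G u v * vol w =
        6%:R^-1 * wedge (wedge (contract u phi) (contract v phi)) phi w].

Definition psi_of (G : 'M[R]_7) (vol : mform 7) (phi : mform 3) : mform 4 :=
  @hodge 3 4 G vol phi.

Definition oct : Type := (R * E)%type.

Definition oct_Im (A : oct) : oct := (0, A.2).
Definition oct_conj (A : oct) : oct := (A.1, - A.2).
Definition oct_add (A B : oct) : oct := (A.1 + B.1, A.2 + B.2).
Definition oct_sub (A B : oct) : oct := (A.1 - B.1, A.2 - B.2).
Definition oct_opp (A : oct) : oct := (- A.1, - A.2).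
Definition oct_ip (G : 'M[R]_7) (A B : oct) : R := A.1 * B.1 + ip G A.2 B.2.
Definition oct_norm2 (G : 'M[R]_7) (A : oct) : R := oct_ip G A A.
Definition oct_norm (G : 'M[R]_7) (A : oct) : R := Num.sqrt (oct_norm2 G A).

Definition cross (G : 'M[R]_7) (phi : mform 3) (x y : E) : E :=
  (\row_k phi (vec3 x y (ebase k))) *m invmx G.

Lemma crossP (G : 'M[R]_7) (phi : mform 3) (x y z : E) :
  G \in unitmx -> multilinear phi ->
  ip G (cross G phi x y) z = phi (vec3 x y z).
Proof.
move=> uG mphi; rewrite /cross ip_invmx//.
pose L w : R^o := phi (vec3 x y w).
have E3 w : vec3 x y w = [eta vec3 x y 0 with ord_max |-> w].
  by apply/boolp.funext => -[[|[|[|m]]] im].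
have lL : linear L by move=> a u w; rewrite /L (E3 (_ + _)) (E3 u) (E3 w) mphi.
pose Lm := GRing.isLinear.Build R E R^o *:%R L lL.
pose LL : {linear E -> R^o} := HB.pack L Lm.
rewrite -/(L z) -[L]/(LL : E -> R^o) [in RHS](row_ebase z) linear_sum.
by apply: eq_bigr => k _; rewrite linearZ /= !mxE mulrC.
Qed.

Definition oct_mul (G : 'M[R]_7) (phi : mform 3) (A B : oct) : oct :=
  (A.1 * B.1 - ip G A.2 B.2, A.1 *: B.2 + B.1 *: A.2 + cross G phi A.2 B.2).

Definition oct_inv (G : 'M[R]_7) (A : oct) : oct :=
  ((oct_norm2 G A)^-1 * (oct_conj A).1, (oct_norm2 G A)^-1 *: (oct_conj A).2).

Definition oct_Ad (G : 'M[R]_7) (phi : mform 3) (V A : oct) : oct :=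
  oct_mul G phi (oct_mul G phi V A) (oct_inv G V).

Definition sigma_at (G : 'M[R]_7) (vol : mform 7) (phi : mform 3) (A : oct) :
    mform 3 := fun v =>
  (oct_norm2 G A)^-1 *
  ((A.1 ^+ 2 - ip G A.2 A.2) * phi v
   - 2%:R * A.1 * contract A.2 (psi_of G vol phi) v
   + 2%:R * wedge (flat G A.2) (contract A.2 phi) v).

End LinearAlgebra.

Arguments mform : clear implicits.
Arguments oct : clear implicits.

Section Calculus.
Context {R : realType}.
Local Notation E := ('rV[R]_7).

Fixpoint Ck_on (k : nat) (U : set E) (f : E -> R) : Prop :=
  if k is k'.+1 then
    (forall x, U x -> differentiable f x) /\
    (forall v : E, Ck_on k' U (fun x => 'D_v f x))
  else forall x, U x -> {for x, continuous f}.

Definition smooth_on (U : set E) (f : E -> R) : Prop := forall k, Ck_on k U f.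

(* Christoffel symbols Gam(X,Y)^m =
     1/2 (X g(Y,e_k) + Y g(X,e_k) - e_k g(X,Y)) g^{km};
   X and Y are extended with constant coefficients in the chart. *)
Definition christoffel (g : E -> 'M[R]_7) (x X Y : E) : E :=
  2%:R^-1 *:
  ((\row_k ('D_X (fun y => ip (g y) Y (ebase k)) x
            + 'D_Y (fun y => ip (g y) X (ebase k)) x
            - 'D_(ebase k) (fun y => ip (g y) X Y) x)) *m invmx (g x)).

Lemma differentiable_ip (g : E -> 'M[R]_7) (x u v : E) :
  (forall k l, differentiable (fun y => g y k l) x) ->
  differentiable (fun y => ip (g y) u v) x.
Proof.
move=> dg.
have -> : (fun y => ip (g y) u v) =
    \sum_(l < 7) \sum_(k < 7) (u 0 k * v 0 l) \*: (fun y => g y k l : R).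
  apply/boolp.funext => y; rewrite /ip mxE fct_sumE; apply: eq_bigr => l _.
  rewrite fct_sumE !mxE mulr_suml; apply: eq_bigr => k _.
  by rewrite /GRing.scale/= mulrAC.
apply: differentiable_sum => l; apply: differentiable_sum => k.
exact: differentiableZ.
Qed.

(* christoffel is the Levi-Civita connection: the only family that is
   torsion-free and satisfies nabla g = 0. *)
Lemma christoffelP (g : E -> 'M[R]_7) (x : E) (Gam : E -> E -> E) :
  (\forall y \near x, (g y)^T = g y) -> g x \in unitmx ->
  (forall k l, differentiable (fun y => g y k l) x) ->
  ((forall X Y, Gam X Y = Gam Y X) /\
   (forall X u v, 'D_X (fun y => ip (g y) u v) x =
                  ip (g x) (Gam X u) v + ip (g x) u (Gam X v))) <->
  (forall X Y, Gam X Y = christoffel g x X Y).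
Proof.
move=> sg ug dg.
have sgx : (g x)^T = g x by exact: (nbhs_singleton sg).
have dip u v := differentiable_ip u v dg.
have DC X u v : 'D_X (fun y => ip (g y) u v) x = 'D_X (fun y => ip (g y) v u) x.
  by apply: near_eq_derive; near=> y; apply: ipC; near: y.
have Dl X u : linear (fun v => 'D_X (fun y => ip (g y) u v) x : R^o).
  move=> a v w.
  have -> : (fun y => ip (g y) u (a *: v + w)) =
      a \*: (fun y => ip (g y) u v) + (fun y => ip (g y) u w).
    by apply/boolp.funext => y; rewrite ip_linearr.
  rewrite deriveD ?deriveZ//; first exact: diff_derivable.
    by apply: derivableZ; exact: diff_derivable.
  exact: diff_derivable.
have Dx u v : linear (fun X => 'D_X (fun y => ip (g y) u v) x : R^o).
  by move=> a X Y; rewrite !deriveE// linearP.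
have koszul X Y v : ip (g x) (christoffel g x X Y) v = 2%:R^-1 *
    ('D_X (fun y => ip (g y) Y v) x + 'D_Y (fun y => ip (g y) X v) x
     - 'D_v (fun y => ip (g y) X Y) x).
  rewrite /christoffel -[_ *: _]addr0 ip_linearl.
  have -> : ip (g x) 0 v = 0 by rewrite /ip !mul0mx mxE.
  rewrite addr0 ip_invmx//; congr (_ * _).
  pose L w : R^o := 'D_X (fun y => ip (g y) Y w) x
    + 'D_Y (fun y => ip (g y) X w) x - 'D_w (fun y => ip (g y) X Y) x.
  have lL : linear L.
    by move=> a v' w; rewrite /L Dl Dl Dx /GRing.scale /=; ring.
  pose Lm := GRing.isLinear.Build R E R^o *:%R L lL.
  pose LL : {linear E -> R^o} := HB.pack L Lm.
  rewrite -/(L v) -[L]/(LL : E -> R^o) [in RHS](row_ebase v) linear_sum.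
  by apply: eq_bigr => k _; rewrite linearZ /= !mxE mulrC.
split=> [[GC Gm] X Y|GE].
  apply: (ip_inj ug) => v; rewrite koszul (Gm X Y v) (Gm Y X v) (Gm v X Y).
  rewrite (GC Y X) (GC v X) (GC v Y) [ip (g x) (Gam X v) Y]ipC//.
  by field.
split=> [X Y|X u v]; last first.
  rewrite !GE koszul [X in _ + X]ipC// koszul.
  by rewrite (DC X v u) (DC v X u) (DC u X v) (DC v u X) (DC u v X); field.
rewrite !GE; apply: (ip_inj ug) => v; rewrite !koszul (DC v X Y).
by rewrite [X in _ * (X - _)]addrC.
Unshelve. all: by end_near. Qed.

Definition nabla_vec (g : E -> 'M[R]_7) (al : E -> E) (x X : E) : E :=
  (\row_k 'D_X (fun y => al y 0 k) x) + christoffel g x X (al x).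

Definition nabla_oct (g : E -> 'M[R]_7) (A : E -> oct R) (x X : E) : oct R :=
  ('D_X (fun y => (A y).1) x, nabla_vec g (fun y => (A y).2) x X).

Definition nabla_form k (g : E -> 'M[R]_7) (w : E -> mform R k) (x X : E) :
    mform R k := fun v =>
  'D_X (fun y => w y v) x
  - \sum_(m < k) w x [eta v with m |-> christoffel g x X (v m)].

(* X |-> T_X = (0, X^a T_a^b), for the components T_{ab} of a 2-tensor. *)
Definition oct_of_tensor (G T : 'M[R]_7) (X : E) : oct R :=
  (0, X *m T *m invmx G).

End Calculus.

Record manifold7 (R : realType) := Manifold7 {
  carrier :> topologicalType;
  chart : Type;
  cdom : chart -> set carrier;
  ccod : chart -> set 'rV[R]_7;
  coord : chart -> carrier -> 'rV[R]_7;
  point_at : chart -> 'rV[R]_7 -> carrier;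
  manifold_hausdorff : hausdorff_space carrier;
  manifold_second_countable : @second_countable carrier;
  cdom_open : forall i, open (cdom i);
  ccod_open : forall i, open (ccod i);
  coord_cod : forall i p, cdom i p -> ccod i (coord i p);
  point_dom : forall i x, ccod i x -> cdom i (point_at i x);
  coordK : forall i p, cdom i p -> point_at i (coord i p) = p;
  point_atK : forall i x, ccod i x -> coord i (point_at i x) = x;
  coord_continuous : forall i p, cdom i p -> {for p, continuous (coord i)};
  point_continuous : forall i x, ccod i x -> {for x, continuous (point_at i)};
  charts_cover : forall p, exists i, cdom i p;
  transition_smooth : forall i j k,
    smooth_on (ccod i `&` (point_at i @^-1` cdom j))
      (fun x => coord j (point_at i x) 0 k)
}.

Section Fields.
Context {R : realType} (M : manifold7 R).
Local Notation E := ('rV[R]_7).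

Definition overlap (i j : chart M) : set E :=
  ccod i `&` (point_at i @^-1` cdom j).

Definition transition (i j : chart M) (x : E) : E := coord j (point_at i x).

(* u *m jacobian i j x is the push-forward of u under transition i j at x. *)
Definition jacobian (i j : chart M) (x : E) : 'M[R]_7 :=
  \matrix_(k, l) 'D_(ebase k) (fun y => transition i j y 0 l) x.

(* A field is given by its components F i x in each chart i, as a function of
   the coordinates x; the values for x outside ccod i are irrelevant. *)
Definition chart_field (S : Type) : Type := chart M -> E -> S.

Definition smooth_form k (w : chart_field (mform R k)) : Prop :=
  [/\ forall i x, ccod i x -> multilinear (w i x) /\ alternating (w i x),
      forall i v, smooth_on (ccod i) (fun x => w i x v) &
      forall i j x v, overlap i j x ->
        w i x v = w j (transition i j x) (fun m => v m *m jacobian i j x)].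

Definition smooth_tensor2 (T : chart_field 'M[R]_7) : Prop :=
  (forall i k l, smooth_on (ccod i) (fun x => T i x k l)) /\
  (forall i j x, overlap i j x ->
    T i x = jacobian i j x *m T j (transition i j x) *m (jacobian i j x)^T).

Definition oct_section (A : chart_field (oct R)) : Prop :=
  [/\ forall i, smooth_on (ccod i) (fun x => (A i x).1),
      forall i k, smooth_on (ccod i) (fun x => (A i x).2 0 k) &
      forall i j x, overlap i j x ->
        (A j (transition i j x)).1 = (A i x).1 /\
        (A j (transition i j x)).2 = (A i x).2 *m jacobian i j x].

Definition nowhere_vanishing (A : chart_field (oct R)) : Prop :=
  forall i x, ccod i x -> A i x <> (0, 0).

Definition constant_norm (g : chart_field 'M[R]_7) (A : chart_field (oct R)) : Prop :=
  exists c : R, forall i x, ccod i x -> oct_norm (g i x) (A i x) = c.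

Definition G2_structure (phi : chart_field (mform R 3)) : Prop :=
  smooth_form phi /\ forall i x, ccod i x -> positive_form (phi i x).

Definition associated_metric (phi : chart_field (mform R 3)) (g : chart_field 'M[R]_7)
    (vol : chart_field (mform R 7)) : Prop :=
  [/\ smooth_tensor2 g, smooth_form vol &
      forall i x, ccod i x -> associated_metric_at (phi i x) (g i x) (vol i x)].

(* nabla_X phi = 2 (X^a T_a^e) e_e _| psi, where g, vol, nabla and psi all come
   from phi.  Since e |-> e _| psi is injective, the equation determines T in
   every chart, so that its smoothness and its transformation law need not be
   required here. *)
Definition is_torsion (phi : chart_field (mform R 3)) (T : chart_field 'M[R]_7) : Prop :=
  exists g vol, associated_metric phi g vol /\
    forall i x X v, ccod i x ->
      nabla_form (g i) (phi i) x X v =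
      2%:R * contract (oct_of_tensor (g i x) (T i x) X).2
                      (psi_of (g i x) (vol i x) (phi i x)) v.

Definition sigma (g : chart_field 'M[R]_7) (vol : chart_field (mform R 7))
    (V : chart_field (oct R)) (phi : chart_field (mform R 3)) : chart_field (mform R 3) :=
  fun i x => sigma_at (g i x) (vol i x) (phi i x) (V i x).

Definition torsion_form (g T : chart_field 'M[R]_7) (i : chart M) (x X : E) : oct R :=
  oct_of_tensor (g i x) (T i x) X.

Definition nabla (g : chart_field 'M[R]_7) (A : chart_field (oct R)) (i : chart M)
    (x X : E) : oct R := nabla_oct (g i) (A i) x X.

Definition inv_section (g : chart_field 'M[R]_7) (A : chart_field (oct R)) :
    chart_field (oct R) := fun i x => oct_inv (g i x) (A i x).

(* D_X A = nabla_X A - A T_X *)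
Definition octD (phi : chart_field (mform R 3)) (g T : chart_field 'M[R]_7)
    (A : chart_field (oct R)) (i : chart M) (x X : E) : oct R :=
  oct_sub (nabla g A i x X)
       (oct_mul (g i x) (phi i x) (A i x) (torsion_form g T i x X)).

End Fields.

(* Main.v *)
From HB Require Import structures.
Require Import Defs.
From mathcomp Require Import all_boot all_order all_algebra all_fingroup.
From mathcomp Require Import all_classical all_reals all_analysis.
From mathcomp Require Import ring.

(* Everything is invariant under linear changes of coordinates, so every
   pointwise identity may be checked in a frame F with phi = phi0(. F), and then
   G = F F^T and vol = det(. F).  The group G2 acts transitively on lines
   (six Givens rotations preserving phi0 make any vector a multiple of e_1),
   so that moreover V = (a, b e_1); there sigma_V(phi) = phi0(. F Q) for a
   rotation Q of the plane (e_2, e_3), which shows that sigma_V(phi) induces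
   the same metric and volume form as phi.

   Since psi(x,y,z,w) = <x * y, z * w> - <x,z><y,w> + <x,w><y,z>, where * is the
   cross product, sigma_V(phi) is algebraic in g, phi and V, and nabla g = 0,
   nabla phi = 2 T _| psi give nabla sigma_V(phi) by the product rule.  In the
   frame above it is a polynomial identity that the result is the contraction
   of 2 Im(Ad_V T + V nabla V^-1) with the Hodge dual of sigma_V(phi), and the
   contraction is injective. *)

Set Implicit Arguments.
Unset Strict Implicit.
Unset Printing Implicit Defensive.

Import Order.TTheory GRing.Theory Num.Theory.
Import numFieldNormedType.Exports.
Local Open Scope ring_scope.

(* The libraries loaded after Defs define other notions of these names. *)
Local Notation contract := Defs.contract.
Local Notation alternating := Defs.alternating.

(** * Multilinear and alternating forms *)

Section MultilinearForms.
Context {R : realType}.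
Local Notation E := ('rV[R]_7).

(** An adapted frame is chosen separately at each point, with no regularity in the point, so it
    cannot be differentiated. Hence the product rule is applied to a frame-free expression, which
    yields [sigma_variation], and a frame enters only afterwards, at the single point under
    consideration. Derivatives are at hand for the metric and for phi but not for the Hodge star;
    replacing psi by cross products leaves only terms whose derivatives follow from these two. The
    derivative of |V|^-2 never has to be tracked inside V nabla V^-1: it contributes a multiple of V
    conj V, which is real and disappears under Im. This is why a free constant [c] runs through the
    pointwise statements. Since the definition of torsion quantifies existentially over the metric,
    uniqueness of the associated metric and volume form matters as much as existence: it ensures
    that the torsions of phi and of sigma_V(phi) are measured with the same g, vol and nabla. *)

Lemma scalar_row_sum (L : E -> R) (x : E) :
  (forall a x y, L (a *: x + y) = a * L x + L y) ->
  L x = \sum_k x 0 k * L (ebase k).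
Proof.
move=> lL; pose L' x : R^o := L x.
pose Lm := GRing.isLinear.Build R E R^o *:%R L' lL.
pose LL : {linear E -> R^o} := HB.pack L' Lm.
rewrite -[L]/(LL : E -> R^o) [in LHS](Defs.row_ebase x) linear_sum.
by apply: eq_bigr => k _; rewrite linearZ.
Qed.

Lemma vcons_eta k (v : 'I_k.+1 -> E) :
  vcons (v ord0) (fun m => v (lift ord0 m)) = v.
Proof. by apply/funext => m; rewrite /vcons; case: unliftP => [n|] ->. Qed.

Lemma with_lift_vcons k (x y : E) (v : 'I_k -> E) (m : 'I_k) :
  [eta vcons x v with lift ord0 m |-> y] =
  vcons x [eta v with m |-> y] :> ('I_k.+1 -> E).
Proof.
apply/funext => i /=; rewrite /vcons; case: unliftP => [n|] ->.
  by rewrite (inj_eq lift_inj).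
by rewrite (negbTE (neq_lift _ _)).
Qed.

Lemma with_ord0_vcons k (x y : E) (v : 'I_k -> E) :
  [eta vcons x v with ord0 |-> y] = vcons y v :> ('I_k.+1 -> E).
Proof.
apply/funext => i /=; rewrite /vcons; case: unliftP => [n|] ->.
  by rewrite eq_sym (negbTE (neq_lift _ _)).
by rewrite eqxx.
Qed.

Lemma multilinear_contract k (w : mform R k.+1) x :
  multilinear w -> multilinear (contract x w).
Proof. by move=> mw v m a y z; rewrite /contract -!with_lift_vcons mw. Qed.

Lemma contract_linear k (w : mform R k.+1) v a x y : multilinear w ->
  contract (a *: x + y) w v = a * contract x w v + contract y w v.
Proof.
move=> mw; have E z := with_ord0_vcons 0 z v.
by rewrite /Defs.contract -(E (a *: x + y)) mw !E.
Qed.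

(** Induction on the degree, contracting the first slot with a basis vector. This is what turns
    identities between forms into finite tables. *)
Lemma mform_ext k (w1 w2 : mform R k) : multilinear w1 -> multilinear w2 ->
  (forall f : 'I_k -> 'I_7,
    w1 (fun m => ebase (f m)) = w2 (fun m => ebase (f m))) ->
  forall v, w1 v = w2 v.
Proof.
elim: k => [|k IH] in w1 w2 * => m1 m2 w12 v.
  have -> : v = (fun m => ebase ((fun=> ord0) m)) by apply/funext => -[].
  exact: w12.
rewrite -(vcons_eta v) -!/(contract _ _ _).
rewrite !(@scalar_row_sum (fun x => contract x _ _)); last first.
- by move=> a x y; rewrite contract_linear.
- by move=> a x y; rewrite contract_linear.
apply: eq_bigr => j _; congr (_ * _).
apply: IH; [exact: multilinear_contract..|] => f.
have := w12 (fun m => if unlift ord0 m is Some n then f n else j).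
suff -> : (fun m => ebase (if unlift ord0 m is Some n then f n else j)) =
  vcons (ebase j) (fun m => ebase (f m)) :> ('I_k.+1 -> E) by [].
by apply/funext => m; rewrite /vcons; case: unlift.
Qed.

Lemma multilinearZ k (c : R) (w : mform R k) :
  multilinear w -> multilinear (fun v => c * w v).
Proof. by move=> mw v m a x y; rewrite mw; ring. Qed.

Lemma multilinear_sum k I (r : seq I) (P : pred I) (w : I -> mform R k) :
  (forall i, multilinear (w i)) ->
  multilinear (fun v => \sum_(i <- r | P i) w i v).
Proof.
move=> mw v m a x y; rewrite mulr_sumr -big_split.
by apply: eq_bigr => i _; exact: mw.
Qed.

Lemma multilinear_prod k (c : 'I_k -> 'I_7) :
  multilinear (fun v : 'I_k -> E => \prod_m v m 0 (c m)).
Proof.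
move=> v m a x y.
rewrite (bigD1 m)//= [in X in _ = a * X + _](bigD1 m)//=.
rewrite [in X in _ = _ + X](bigD1 m)//= eqxx !mxE.
have P z : \prod_(i | i != m) (if i == m then z else v i) 0 (c i) =
    \prod_(i | i != m) v i 0 (c i) :> R.
  by apply: eq_bigr => i /negbTE ->.
by rewrite !P; ring.
Qed.

Lemma mform_expand k (w : mform R k) v : multilinear w ->
  w v = \sum_(f : {ffun 'I_k -> 'I_7})
    (\prod_m v m 0 (f m)) * w (fun m => ebase (f m)).
Proof.
move=> mw; move: v; apply: mform_ext => //.
  apply: multilinear_sum => f v m a x y.
  by rewrite multilinear_prod; ring.
move=> f; rewrite (bigD1 [ffun m => f m])//= [X in _ + X]big1 ?addr0.
  rewrite big1 ?mul1r => [|m _]; last by rewrite ffunE mxE !eqxx.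
  by congr w; apply/funext => m; rewrite ffunE.
move=> g gf; have [m gm] : exists m, g m != f m.
  apply/existsP; apply: contraR gf; rewrite negb_exists => /forallP gf.
  by apply/eqP/ffunP => m; rewrite ffunE; apply/eqP; rewrite -[_ == _]negbK.
by rewrite (bigD1 m)//= mxE (negbTE gm) andbF !mul0r.
Qed.

Lemma alternating_tperm k (w : mform R k) (v : 'I_k -> E) (m n : 'I_k) :
  multilinear w -> alternating w -> m != n ->
  w (fun i => v (tperm m n i)) = - w v.
Proof.
move=> mw aw mn.
pose u x y : 'I_k -> E := [eta [eta v with m |-> x] with n |-> y].
have Dl x x' y : w (u (x + x') y) = w (u x y) + w (u x' y).
  have uE z : u z y = [eta [eta v with n |-> y] with m |-> z].
    apply/funext => i; rewrite /u /=; case: eqVneq => // ->.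
    by rewrite eq_sym (negbTE mn).
  by rewrite !uE -{1}[x]scale1r mw mul1r.
have Dr x y y' : w (u x (y + y')) = w (u x y) + w (u x y').
  by rewrite /u -{1}[y]scale1r mw mul1r.
have u0 x : w (u x x) = 0.
  by apply: (aw _ m n mn); rewrite /u /= !eqxx (negbTE mn).
(* Polarisation: with v_m + v_n in both slots the form vanishes, and only the two mixed terms
   survive the expansion. *)
have := u0 (v m + v n); rewrite Dl !Dr !u0 add0r addr0 => /eqP.
rewrite addrC addr_eq0 => /eqP.
have -> : u (v m) (v n) = v.
  apply/funext => i; rewrite /u /=.
  by case: (i =P n) => [->|_] //; case: (i =P m) => [->|].
move=> <-; congr w; apply/funext => i; rewrite /u /=.
case: tpermP => [->|->|/eqP im /eqP inn].
- by rewrite (negbTE mn) eqxx.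
- by rewrite eqxx.
- by rewrite (negbTE im) (negbTE inn).
Qed.

Lemma alternating_perm k (w : mform R k) (s : 'S_k) (v : 'I_k -> E) :
  multilinear w -> alternating w -> w (fun i => v (s i)) = (-1) ^+ s * w v.
Proof.
move=> mw aw; have [ts -> /allP ats] := prod_tpermP s.
elim: ts ats v => [|t ts IH] ats v.
  rewrite big_nil odd_perm1 mul1r; congr w.
  by apply/funext => i; rewrite perm1.
have dt : t.1 != t.2 by apply: (ats t); rewrite mem_head.
rewrite big_cons odd_mul_tperm dt /= signrN mulNr.
rewrite -IH => [|t' t'ts]; last by apply: ats; rewrite inE t'ts orbT.
rewrite -(alternating_tperm _ mw aw dt); congr w.
by apply/funext => i; rewrite permM.
Qed.

Definition vol0 : mform R 7 := fun v => \det (\matrix_(i < 7) v i).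

Lemma multilinear_vol0 : multilinear vol0.
Proof.
move=> v m a x y; rewrite /vol0.
rewrite (@determinant_multilinear _ _ _
  (\matrix_i [eta v with m |-> x] i) (\matrix_i [eta v with m |-> y] i) m a 1).
- by rewrite mul1r.
- by rewrite !rowK /= eqxx scale1r.
- by apply/row_matrixP => i; rewrite !row_rowsub !rowK /= eq_sym (negbTE (neq_lift _ _)).
- by apply/row_matrixP => i; rewrite !row_rowsub !rowK /= eq_sym (negbTE (neq_lift _ _)).
Qed.

Lemma alternating_vol0 : alternating vol0.
Proof.
move=> v m n mn vmn; rewrite /vol0; apply: (determinant_alternate mn) => j.
by rewrite !mxE vmn.
Qed.

Lemma vol0_ebase : vol0 ebase = 1.
Proof.
rewrite /vol0 (_ : \matrix_i _ = 1%:M) ?det1//.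
by apply/row_matrixP => i; rewrite rowK row1.
Qed.

(** Forms of top degree make up a line spanned by the determinant. On basis tuples, either the
    indices are a permutation and both sides produce its sign, or an index repeats and both
    vanish. *)
Lemma top_formE (w : mform R 7) v : multilinear w -> alternating w ->
  w v = vol0 v * w ebase.
Proof.
move=> mw aw; move: v; apply: mform_ext => //.
  by move=> v m a x y; rewrite multilinear_vol0; ring.
move=> f; have [/injectiveP fi|/injectivePn[m [n mn fmn]]] := boolP (injectiveb f).
  have fE i : f i = perm fi i by rewrite permE.
  have -> : (fun m => ebase (f m)) = (fun m => ebase (perm fi m)) :> ('I_7 -> E).
    by apply/funext => m; rewrite fE.
  rewrite (alternating_perm (perm fi) ebase mw aw).
  rewrite (alternating_perm _ ebase multilinear_vol0 alternating_vol0).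
  by rewrite vol0_ebase mulr1.
have fE : ebase (f m) = ebase (f n) :> E by rewrite fmn.
by rewrite (alternating_vol0 mn fE) (aw _ m n mn fE) mul0r.
Qed.

Lemma multilinear_comp_perm k (w : mform R k) (s : 'S_k) : multilinear w ->
  multilinear (fun v => w (fun i => v (s i))).
Proof.
move=> mw v m a x y.
have E z : (fun i => [eta v with m |-> z] (s i)) =
    [eta (fun i => v (s i)) with (s^-1)%g m |-> z].
  by apply/funext => i /=; rewrite -(inj_eq (@perm_inj _ s)) permKV.
by rewrite !E mw.
Qed.

Definition tensor k l (a : mform R k) (b : mform R l) : mform R (k + l) :=
  fun v => a (fun m => v (lshift l m)) * b (fun m => v (rshift k m)).

Lemma multilinear_tensor k l (a : mform R k) (b : mform R l) :
  multilinear a -> multilinear b -> multilinear (tensor a b).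
Proof.
move=> ma mb v m c x y; rewrite /tensor; case: (split_ordP m) => i ->.
  have El z : (fun n => [eta v with lshift l i |-> z] (lshift l n)) =
      [eta (fun n => v (lshift l n)) with i |-> z].
    by apply/funext => n /=; rewrite eq_lshift.
  have Er z : (fun n => [eta v with lshift l i |-> z] (rshift k n)) =
      (fun n => v (rshift k n)).
    by apply/funext => n /=; rewrite eq_rlshift.
  by rewrite !El !Er ma; ring.
have El z : (fun n => [eta v with rshift k i |-> z] (lshift l n)) =
    (fun n => v (lshift l n)).
  by apply/funext => n /=; rewrite eq_lrshift.
have Er z : (fun n => [eta v with rshift k i |-> z] (rshift k n)) =
    [eta (fun n => v (rshift k n)) with i |-> z].
  by apply/funext => n /=; rewrite eq_rshift.
by rewrite !El !Er mb; ring.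
Qed.

Lemma multilinear_wedge k l (a : mform R k) (b : mform R l) :
  multilinear a -> multilinear b -> multilinear (wedge a b).
Proof.
move=> ma mb; apply: multilinearZ; apply: multilinear_sum => s.
apply: multilinearZ.
exact: (multilinear_comp_perm s (multilinear_tensor ma mb)).
Qed.

Lemma alternating_wedge k l (a : mform R k) (b : mform R l) :
  alternating (wedge a b).
Proof.
move=> v m n mn vmn; rewrite /wedge; apply/eqP; rewrite mulf_eq0; apply/orP; right.
(* Composing with the transposition of m and n keeps the arguments, as v m = v n, and flips the
   sign; the sum equals its opposite, hence vanishes in characteristic 0. *)
set S := \sum_s _; have : S = - S.
  rewrite {1}/S (reindex_inj (mulIg (tperm m n))) -sumrN; apply: eq_bigr => s _.
  rewrite odd_permM odd_tperm mn addbT signrN mulNr.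
  have vE i : v ((s * tperm m n)%g i) = v (s i).
    by rewrite permM; case: tpermP => // ->.
  congr (- (_ * (_ * _))); [congr a|congr b]; by apply/funext => i; rewrite vE.
by move=> /eqP; rewrite -addr_eq0 -mulr2n mulrn_eq0.
Qed.

Lemma contract_comp k (w : mform R k.+1) (F : 'M[R]_7) x :
  contract x (fun v => w (fun m => v m *m F)) =
  (fun v => contract (x *m F) w (fun m => v m *m F)).
Proof.
apply/funext => v; rewrite /contract; congr w; apply/funext => m.
by rewrite /vcons; case: unlift.
Qed.

Lemma multilinear_comp k (w : mform R k) (F : 'M[R]_7) : multilinear w ->
  multilinear (fun v => w (fun m => v m *m F)).
Proof.
move=> mw v m a x y.
have E z : (fun i => [eta v with m |-> z] i *m F) =
    [eta (fun i => v i *m F) with m |-> z *m F].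
  by apply/funext => i /=; case: eqP.
by rewrite !E mulmxDl -scalemxAl mw.
Qed.

(** The rows of [invmx F] form an orthonormal basis for F F^T. Factoring the inverse metric through
    them collapses the double sum over I and J to one sum over tuples of this basis. *)
Lemma hodge_frame k l (F : 'M[R]_7) (vol : mform R (k + l)) (w : mform R k) v :
  F \in unitmx -> multilinear w -> multilinear vol ->
  hodge (F *m F^T) vol w v =
  (k`!)%:R^-1 * \sum_(K : {ffun 'I_k -> 'I_7})
    w (fun m => ebase (K m) *m invmx F) *
    vol (vcat (fun m => ebase (K m) *m invmx F) v).
Proof.
move=> uF mw mvol; rewrite /hodge; congr (_ * _).
have invE : invmx (F *m F^T) = (invmx F)^T *m invmx F.
  apply: (can_inj (mulKmx (_ : F *m F^T \in unitmx))).
    by rewrite unitmx_mul unitmx_tr uF.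
  rewrite mulmxV ?unitmx_mul ?unitmx_tr ?uF// -mulmxA (mulmxA F^T) -trmx_mul.
  by rewrite mulVmx// trmx1 mul1mx mulmxV.
set H := invmx F in invE *.
have mv : multilinear (fun u : 'I_k -> E => vol (vcat u v)).
  move=> u m a x y.
  have E z : vcat [eta u with m |-> z] v = [eta vcat u v with lshift l m |-> z].
    apply/funext => i /=; rewrite /vcat; case: split_ordP => j -> /=.
      by rewrite eq_lshift.
    by rewrite eq_rlshift.
  by rewrite !E mvol.
transitivity (\sum_(K : {ffun 'I_k -> 'I_7})
  (\sum_(J : {ffun 'I_k -> 'I_7}) (\prod_m H (K m) (J m)) * w (fun m => ebase (J m))) *
  (\sum_(I : {ffun 'I_k -> 'I_7})
    (\prod_m H (K m) (I m)) * vol (vcat (fun m => ebase (I m)) v))).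
  under [RHS]eq_bigr => K _ do rewrite mulr_suml.
  rewrite [RHS]exchange_big /=.
  under [RHS]eq_bigr => J _.
    under eq_bigr => K _ do rewrite mulr_sumr.
    rewrite exchange_big /=; over.
  rewrite [RHS]exchange_big /=; apply: eq_bigr => I _; apply: eq_bigr => J _.
  have -> : \prod_(m < k) invmx (F *m F^T) (I m) (J m) =
      \sum_(K : {ffun 'I_k -> 'I_7}) \prod_m (H (K m) (I m) * H (K m) (J m)).
    rewrite -(bigA_distr_bigA (fun m j => H j (I m) * H j (J m))).
    by apply: eq_bigr => m _; rewrite invE mxE; apply: eq_bigr => j _; rewrite mxE.
  rewrite mulr_suml mulr_suml; apply: eq_bigr => K _; rewrite big_split /=; ring.
apply: eq_bigr => K _; congr (_ * _).
  rewrite [RHS]mform_expand//; apply: eq_bigr => J _; congr (_ * _).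
  by apply: eq_bigr => m _; rewrite /ebase -rowE mxE.
rewrite [RHS](@mform_expand _ (fun u : 'I_k -> E => vol (vcat u v)))//.
apply: eq_bigr => J _; congr (_ * _).
by apply: eq_bigr => m _; rewrite /ebase -rowE mxE.
Qed.

End MultilinearForms.

(** * The standard forms as polynomials in coordinates *)

Section Polynomials.
Context {R : comNzRingType}.
Implicit Types x y z w : nat -> R.

(** Vectors become functions on [nat], with indices from 0, over an arbitrary commutative ring: the
    same formulas serve [ring] over the reals and [vm_compute] over [int]. *)
Definition minor2 (p q : nat) x y : R := x p * y q - x q * y p.

Definition minor3 (p q r : nat) x y z : R :=
  x p * minor2 q r y z - x q * minor2 p r y z + x r * minor2 p q y z.

Definition minor4 (p q r s : nat) x y z w : R :=
  x p * minor3 q r s y z w - x q * minor3 p r s y z w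
  + x r * minor3 p q s y z w - x s * minor3 p q r y z w.

Definition pphi x y z : R :=
  minor3 0 1 2 x y z + minor3 0 3 4 x y z + minor3 0 5 6 x y z
  + minor3 1 3 5 x y z - minor3 1 4 6 x y z - minor3 2 3 6 x y z
  - minor3 2 4 5 x y z.

Definition ppsi x y z w : R :=
  minor4 3 4 5 6 x y z w + minor4 1 2 5 6 x y z w + minor4 1 2 3 4 x y z w
  + minor4 0 2 4 6 x y z w - minor4 0 2 3 5 x y z w - minor4 0 1 4 5 x y z w
  - minor4 0 1 3 6 x y z w.

Definition pdot x y : R :=
  x 0%N * y 0%N + x 1%N * y 1%N + x 2%N * y 2%N + x 3%N * y 3%N
  + x 4%N * y 4%N + x 5%N * y 5%N + x 6%N * y 6%N.

Definition pcross x y (k : nat) : R :=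
  match k with
  | 0 => minor2 1 2 x y + minor2 3 4 x y + minor2 5 6 x y
  | 1 => - minor2 0 2 x y + minor2 3 5 x y - minor2 4 6 x y
  | 2 => minor2 0 1 x y - minor2 3 6 x y - minor2 4 5 x y
  | 3 => - minor2 0 4 x y - minor2 1 5 x y + minor2 2 6 x y
  | 4 => minor2 0 3 x y + minor2 1 6 x y + minor2 2 5 x y
  | 5 => - minor2 0 6 x y + minor2 1 3 x y - minor2 2 4 x y
  | 6 => minor2 0 5 x y - minor2 1 4 x y - minor2 2 3 x y
  | _ => 0
  end.

Definition pdelta (i k : nat) : R := (k == i)%:R.

Fixpoint sign_perms n : seq (bool * seq nat) :=
  if n is n'.+1 then
    [seq (odd j (+) p.1, j :: map (bump j) p.2) | j <- iota 0 n, p <- sign_perms n']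
  else [:: (false, [::])].

Lemma sign_permsS n : sign_perms n.+1 =
  [seq (odd j (+) p.1, j :: map (bump j) p.2) | j <- iota 0 n.+1, p <- sign_perms n].
Proof. by []. Qed.

Lemma size_sign_perms n p : p \in sign_perms n -> size p.2 = n.
Proof.
elim: n p => [|n IH] p; first by rewrite inE => /eqP ->.
rewrite sign_permsS.
by move=> /allpairsP[[j q] [_ /IH qn ->]] /=; rewrite size_map qn.
Qed.

(** Replaces the sum over the symmetric group by an explicit list, so that wedge products can be
    unfolded and evaluated. *)
Lemma sum_sign_perms n (F : ('I_n -> nat) -> R) :
  \sum_(s : 'S_n) (-1) ^+ s * F (fun i => s i) =
  \sum_(p <- sign_perms n) (-1) ^+ p.1 * F (fun i => nth 0%N p.2 i).
Proof.
elim: n F => [|n IH] F.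
  rewrite big_seq1 (bigD1 1%g)//= big1 ?addr0 ?odd_perm1.
    by congr (_ * F _); apply/funext => -[].
  by move=> s; rewrite (_ : s = 1%g) ?eqxx//; apply/permP => -[].
rewrite (partition_big (fun s : 'S_n.+1 => s ord0) predT)//.
rewrite sign_permsS big_allpairs_dep.
have -> : iota 0 n.+1 = index_iota 0 n.+1 by rewrite /index_iota subn0.
rewrite big_mkord.
apply: eq_bigr => j _.
(* The permutations sending 0 to j are the lifts of smaller ones; [ulsf] recovers the smaller one by
   deleting 0 from the domain and its image from the range. *)
rewrite (reindex (lift_perm ord0 j)); last first.
  pose ulsf i (s : 'S_n.+1) k := odflt k (unlift (s i) (s (lift i k))).
  have ulsfK i (s : 'S_n.+1) k : lift (s i) (ulsf i s k) = s (lift i k).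
    rewrite /ulsf; have := neq_lift i k.
    by rewrite -(can_eq (permK s)) => /unlift_some[] ? ? ->.
  have inj_ulsf : injective (ulsf ord0 _).
    move=> s; apply: can_inj (ulsf (s ord0) s^-1%g) _ => k'.
    by rewrite {1}/ulsf ulsfK !permK liftK.
  exists (fun s => perm (inj_ulsf s)) => [s _ | s].
    by apply/permP=> k'; rewrite permE /ulsf lift_perm_lift lift_perm_id liftK.
  move/(s _ =P _) => si0; apply/permP=> k.
  case: (unliftP ord0 k) => [k'|] ->; rewrite ?lift_perm_id //.
  by rewrite lift_perm_lift -si0 permE ulsfK.
pose G (g : 'I_n -> nat) := (-1) ^+ odd j *
  F (fun i => if unlift ord0 i is Some i' then bump j (g i') else j).
transitivity (\sum_(s : 'S_n) (-1) ^+ s * G (fun i => s i)).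
  apply: eq_big => [s|s _]; first by rewrite lift_perm_id eqxx.
  rewrite odd_lift_perm /= signr_addb /G mulrA [(-1) ^+ s * _]mulrC.
  congr (_ * F _); apply/funext => i; case: unliftP => [i'|] ->.
    by rewrite lift_perm_lift.
  by rewrite lift_perm_id.
rewrite IH; apply: eq_big_seq => p /size_sign_perms sp.
rewrite /G mulrA -signr_addb [p.1 (+) _]addbC; congr (_ * F _).
apply/funext => i; case: unliftP => [i'|] -> //=.
by rewrite add0n (nth_map 0%N) ?sp.
Qed.

End Polynomials.

Section StandardForms.
Context {R : realType}.
Local Notation E := ('rV[R]_7).

(* The value is 0 beyond the last coordinate, so that equality of vectors is
   equality of functions on nat and [coords (ebase i) = pdelta i]. *)
Definition coords (u : E) : nat -> R :=
  fun k => if (k < 7)%N then u 0 (inord k) else 0.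

Lemma coordsP (u v : E) : (forall k, (k < 7)%N -> coords u k = coords v k) -> u = v.
Proof.
move=> uv; apply/rowP => k; have := uv k (ltn_ord k).
by rewrite /coords ltn_ord inord_val.
Qed.

Lemma sum7 (F : 'I_7 -> R) : \sum_k F k =
  F (inord 0) + F (inord 1) + F (inord 2) + F (inord 3) + F (inord 4)
  + F (inord 5) + F (inord 6).
Proof.
rewrite !big_ord_recr big_ord0 /= add0r.
by congr (F _ + F _ + F _ + F _ + F _ + F _ + F _);
  apply/val_inj; rewrite /= inordK.
Qed.

Lemma coords_ebase (i : 'I_7) : coords (ebase i) = pdelta i.
Proof.
apply/funext => k; rewrite /coords /pdelta; case: ltnP => [k7|k7].
  by rewrite mxE eqxx -(inj_eq val_inj) /= inordK.
by case: eqP => // ki; move: (ltn_ord i); rewrite -ki ltnNge k7.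
Qed.

(** [v] is defined on all of [nat], so the entries of a listed permutation index it without bound
    proofs. *)
Lemma wedge_perms k l (a : mform R k) (b : mform R l) (v : nat -> E) :
  wedge a b (fun i => v i) = (k`! * l`!)%:R^-1 *
    \sum_(p <- sign_perms (k + l)) (-1) ^+ p.1 *
      (a (fun m => v (nth 0%N p.2 m)) * b (fun m => v (nth 0%N p.2 (k + m)%N))).
Proof.
rewrite /wedge; congr (_ * _).
pose F (g : 'I_(k + l) -> nat) :=
  a (fun m => v (g (lshift l m))) * b (fun m => v (g (rshift k m))).
exact: (sum_sign_perms F).
Qed.

Lemma dx3E p q r (v : nat -> E) :
  (0 < p <= 7)%N -> (0 < q <= 7)%N -> (0 < r <= 7)%N -> dx3 p q r (fun m => v m) =
  minor3 p.-1 q.-1 r.-1 (coords (v 0%N)) (coords (v 1%N)) (coords (v 2%N)).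
Proof.
case: p q r => [|p] [|q] [|r]//= p7 q7 r7.
rewrite /dx3 wedge_perms.
under eq_bigr => s _ do rewrite (wedge_perms _ _ (fun i => v (nth 0%N s.2 i))).
rewrite /= !big_cons !big_nil /= /dx /minor3 /minor2 /coords /= p7 q7 r7.
rewrite (_ : 2`! * 1`! = 2)%N// (_ : 1`! * 1`! = 1)%N//.
by field.
Qed.

Lemma phi0E (v : nat -> E) : phi0 (fun m => v m) =
  pphi (coords (v 0%N)) (coords (v 1%N)) (coords (v 2%N)).
Proof. by rewrite /phi0 !dx3E. Qed.

Lemma phi0_vec3 (x y z : E) : phi0 (vec3 x y z) = pphi (coords x) (coords y) (coords z).
Proof. exact: (phi0E (nth 0 [:: x; y; z])). Qed.

Lemma vec3_eta (v : 'I_3 -> E) : v = vec3 (v (inord 0)) (v (inord 1)) (v (inord 2)).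
Proof.
by apply/funext => -[[|[|[|m]]] im]//; congr v; apply/val_inj; rewrite /= inordK.
Qed.

Lemma coordsD a (x y : E) k : coords (a *: x + y) k = a * coords x k + coords y k.
Proof. by rewrite /coords; case: ifP => _; rewrite ?mxE// mulr0 addr0. Qed.

Lemma multilinear_phi0 : multilinear (phi0 : mform R 3).
Proof.
have P u : phi0 u = pphi (coords (u (inord 0))) (coords (u (inord 1)))
    (coords (u (inord 2))) by rewrite {1}[u]vec3_eta phi0_vec3.
move=> v m a x y; rewrite !P /=.
have mE : m = inord m by rewrite inord_val.
rewrite mE; case: m mE => -[|[|[|m]]] im _ //=;
  rewrite -!(inj_eq val_inj) /= !inordK//= /pphi /minor3 /minor2 !coordsD;
  move: (coords x) (coords y) (coords (v _)) (coords (v _)) => ????; ring.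
Qed.

(* Laplace expansion along the first row of the 0-1 matrix whose row i has its
   one in column l_i. *)
Fixpoint list_sign n (l : seq nat) : int :=
  match n, l with
  | n'.+1, p :: l' =>
    if p \in l' then 0 else (-1) ^+ p * list_sign n' (map (unbump p) l')
  | _, _ => 1
  end.

Lemma det_delta n (l : seq nat) : size l = n -> all (gtn n) l ->
  \det (\matrix_(i < n, j < n) (nth 0%N l i == j)%:R) = (list_sign n l)%:~R :> R.
Proof.
elim: n l => [|n IH] [|p l]//=; first by rewrite det_mx00.
move=> [sl] /andP[pn ln].
case: ifPn => [pl|pl].
  have il : (index p l < n)%N by rewrite -sl index_mem.
  rewrite (@determinant_alternate _ _ _ ord0 (lift ord0 (Ordinal il)))//.
  by move=> j; rewrite !mxE /= nth_index.
pose j0 : 'I_n.+1 := Ordinal pn.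
rewrite (expand_det_row _ ord0) (bigD1 j0)//= big1 ?addr0; last first.
  move=> j jj0; rewrite !mxE/=; case: eqP => [E|]; last by rewrite mul0r.
  by move: jj0; rewrite -(inj_eq val_inj) /= E eqxx.
rewrite mxE /= eqxx mul1r /cofactor /= add0n intrM rmorphXn /= rmorphN1.
congr (_ * _); rewrite -IH ?size_map//; last first.
  apply/allP => _ /mapP[q ql ->] /=; have := allP ln q ql.
  have : q != p by apply: contraNneq pl => <-.
  rewrite /= /unbump neq_ltn; case: ltngtP => //= pq _ qn.
    by rewrite subn0 (leq_trans pq).
  by rewrite subn1 -ltnS prednK// (leq_trans _ pq).
congr (\det _); apply/matrixP => i j; rewrite !mxE (nth_map 0%N) ?sl// lift0.
congr (nat_of_bool _)%:R; apply/eqP/eqP => /= [->|<-].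
  exact: bumpK.
rewrite unbumpK//= inE; apply: contraNneq pl => <-.
by rewrite mem_nth ?sl.
Qed.

End StandardForms.

(** The 42 nonzero components of phi0, as signed index triples: seven monomials, each with its six
    orderings. *)
Definition phi_terms : seq (bool * seq nat) :=
  [seq (l.1 (+) p.1, [seq nth 0 l.2 i | i <- p.2])%N |
    l <- [:: (false, [:: 0; 1; 2]); (false, [:: 0; 3; 4]); (false, [:: 0; 5; 6]);
             (false, [:: 1; 3; 5]); (true, [:: 1; 4; 6]); (true, [:: 2; 3; 6]);
             (true, [:: 2; 4; 5])]%N,
    p <- sign_perms 3].

Lemma pphi_terms (R : comNzRingType) (x y z : nat -> R) :
  pphi x y z = \sum_(t <- phi_terms) (-1) ^+ t.1 *
    (x (nth 0 t.2 0)%N * y (nth 0 t.2 1)%N * z (nth 0 t.2 2)%N).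
Proof.
rewrite /phi_terms /= !big_cons big_nil /= /pphi /minor3 /minor2; ring.
Qed.

Lemma phi_terms_lt t : t \in phi_terms -> size t.2 = 3 /\ all (gtn 7) t.2.
Proof.
have : all (fun t : bool * seq nat => (size t.2 == 3) && all (gtn 7) t.2) phi_terms by [].
by move=> /allP h /h /andP[/eqP].
Qed.

Lemma sum_foldr (R : nmodType) I (s : seq I) (F : I -> R) :
  \sum_(i <- s) F i = foldr (fun i x => F i + x) 0 s.
Proof. by elim: s => [|i s IH]; rewrite ?big_nil// big_cons IH. Qed.

Lemma pphi_intr (R : comNzRingType) (x y z : nat -> int) :
  pphi (fun k => (x k)%:~R : R) (fun k => (y k)%:~R) (fun k => (z k)%:~R) =
  (pphi x y z)%:~R.
Proof.
by rewrite /pphi /minor3 /minor2; ring.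
Qed.

Lemma ppsi_intr (R : comNzRingType) (x y z w : nat -> int) :
  ppsi (fun k => (x k)%:~R : R) (fun k => (y k)%:~R) (fun k => (z k)%:~R)
    (fun k => (w k)%:~R) = (ppsi x y z w)%:~R.
Proof.
by rewrite /ppsi /minor4 /minor3 /minor2; ring.
Qed.

Lemma pdelta_intr (R : comNzRingType) i :
  pdelta i = (fun k => (pdelta i k : int)%:~R) :> (nat -> R).
Proof. by apply/funext => k; rewrite /pdelta; case: eqP. Qed.

(** * Finite verifications over the integers *)

Definition iota7 := iota 0 7.

Definition phi_table : seq (seq (seq int)) :=
  Eval vm_compute in
    [seq [seq [seq pphi (pdelta i) (pdelta j) (pdelta k) | k <- iota7] | j <- iota7]
      | i <- iota7].

Definition phi_int (i j k : nat) : int :=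
  nth 0 (nth [::] (nth [::] phi_table i) j) k.

Lemma phi_intE i j k : (i < 7)%N -> (j < 7)%N -> (k < 7)%N ->
  pphi (pdelta i) (pdelta j) (pdelta k) = phi_int i j k.
Proof.
have : all (fun i => all (fun j => all (fun k =>
    pphi (pdelta i) (pdelta j) (pdelta k) == phi_int i j k) iota7) iota7) iota7.
  by vm_compute.
move=> /allP h i7 j7 k7; apply/eqP.
have /h /allP {}h : i \in iota7 by rewrite mem_iota.
have /h /allP {}h : j \in iota7 by rewrite mem_iota.
by apply: h; rewrite mem_iota.
Qed.

(** The wedge product of e_i _| phi0 and e_j _| phi0 on four listed basis vectors. Both factors are
    antisymmetric, so the six shuffles of type (2,2) suffice. *)
Definition wedge2_int (i j : nat) (l : seq nat) : int :=
  let term p q r s :=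
    let c := phi_int i (nth 0%N l p) (nth 0%N l q) in
    if c == 0 then 0 else c * phi_int j (nth 0%N l r) (nth 0%N l s) in
  term 0%N 1%N 2%N 3%N - term 0%N 2%N 1%N 3%N + term 0%N 3%N 1%N 2%N
  + term 1%N 2%N 0%N 3%N - term 1%N 3%N 0%N 2%N + term 2%N 3%N 0%N 1%N.

Definition phi_perm_value (p : bool * seq nat) : int :=
  phi_int (nth 0%N p.2 4%N) (nth 0%N p.2 5%N) (nth 0%N p.2 6%N).

Definition wedge3_int (ps : seq (bool * seq nat)) (i j : nat) : int :=
  foldr (fun (p : bool * seq nat) s =>
    (-1) ^+ p.1 * (wedge2_int i j p.2 * phi_perm_value p) + s) 0 ps.

(* 864 = 6 * 4! * 3!, the last two factors being the denominators in the
   definition of wedge; permutations are filtered before the evaluation to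
   keep it cheap. *)
Lemma wedge3_intE i j : (i < 7)%N -> (j < 7)%N ->
  wedge3_int [seq p <- sign_perms 7 | phi_perm_value p != 0] i j = 864 * (i == j)%:R.
Proof.
have : let ps := [seq p <- sign_perms 7 | phi_perm_value p != 0] in
    all (fun i => all (fun j =>
      wedge3_int ps i j == if i == j then 864 else 0) iota7) iota7.
  by vm_compute.
move=> /allP h i7 j7.
have /h /allP {}h : i \in iota7 by rewrite mem_iota.
have /h /eqP -> : j \in iota7 by rewrite mem_iota.
by case: eqP => _; rewrite ?mulr1 ?mulr0.
Qed.

(** The left side is 3! times a component of the Hodge dual of phi0: each term pairs a component of
    phi0 with the determinant on the completed list of seven indices. All 7^4 index tuples are
    tested. *)
Lemma psi_int_check a b c d :
  (a < 7)%N -> (b < 7)%N -> (c < 7)%N -> (d < 7)%N ->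
  foldr (fun (t : bool * seq nat) s =>
    (-1) ^+ t.1 * list_sign 7 (t.2 ++ [:: a; b; c; d]) + s) 0 phi_terms
  = 6 * ppsi (pdelta a) (pdelta b) (pdelta c) (pdelta d) :> int.
Proof.
have : all (fun a => all (fun b => all (fun c => all (fun d =>
    foldr (fun (t : bool * seq nat) s =>
    (-1) ^+ t.1 * list_sign 7 (t.2 ++ [:: a; b; c; d]) + s) 0 phi_terms
    == 6 * ppsi (pdelta a) (pdelta b) (pdelta c) (pdelta d) :> int)
    iota7) iota7) iota7) iota7.
  by vm_compute.
move=> /allP h a7 b7 c7 d7; apply/eqP.
have /h /allP {}h : a \in iota7 by rewrite mem_iota.
have /h /allP {}h : b \in iota7 by rewrite mem_iota.
have /h /allP {}h : c \in iota7 by rewrite mem_iota.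
by apply: h; rewrite mem_iota.
Qed.

(** * Metric, volume form and Hodge dual of phi0 *)

Section StandardStructure.
Context {R : realType}.
Local Notation E := ('rV[R]_7).

Lemma vol0_list (l : seq nat) : size l = 7 -> all (gtn 7) l ->
  vol0 (fun i => ebase (inord (nth 0%N l i))) = (list_sign 7 l)%:~R :> R.
Proof.
move=> sl l7; rewrite -det_delta//; congr (\det _); apply/matrixP => i j.
rewrite !mxE eqxx /=; congr (nat_of_bool _)%:R.
rewrite -(inj_eq val_inj) /= inordK 1?eq_sym//.
by apply: (allP l7); rewrite mem_nth ?sl.
Qed.

Lemma multilinear_vcatr k l (w : mform R (k + l)) u : multilinear w ->
  multilinear (fun v : 'I_l -> E => w (vcat u v)).
Proof.
move=> mw v m a x y.
have E z : vcat u [eta v with m |-> z] = [eta vcat u v with rshift k m |-> z].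
  apply/funext => i /=; rewrite /vcat; case: split_ordP => j -> /=.
    by rewrite eq_lrshift.
  by rewrite eq_rshift.
by rewrite !E mw.
Qed.

Lemma hodge_phi0 v : @hodge R 3 4 1%:M vol0 phi0 v = 6^-1 *
  \sum_(t <- phi_terms) (-1) ^+ t.1 *
    vol0 (vcat (fun m : 'I_3 => ebase (inord (nth 0%N t.2 m))) v).
Proof.
have := @hodge_frame R 3 4 1%:M vol0 phi0 v (unitmx1 _ _) multilinear_phi0 multilinear_vol0.
rewrite trmx1 mulmx1 => ->; congr (_ * _).
under eq_bigr => K _.
  rewrite (_ : (fun m => _) = (fun m => ebase (K m)));
    last by apply/funext => m; rewrite invmx1 mulmx1.
  over.
have phiK (K : {ffun 'I_3 -> 'I_7}) : phi0 (fun m => ebase (K m)) =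
    \sum_(t <- phi_terms) (-1) ^+ t.1 *
      \prod_(m < 3) (ebase (inord (nth 0%N t.2 m)) 0 (K m)) :> R.
  rewrite [X in phi0 X]vec3_eta phi0_vec3 pphi_terms; apply: eq_big_seq => t.
  move=> /phi_terms_lt[st t7]; congr (_ * _).
  rewrite !big_ord_recl big_ord0 mulr1 mulrA !coords_ebase /pdelta.
  have D (i : nat) (m : 'I_3) : (i < 3)%N -> m = inord i ->
      (nth 0%N t.2 i == K (inord i))%:R = ebase (inord (nth 0%N t.2 m)) 0 (K m) :> R.
    move=> i3 ->; rewrite mxE eqxx inordK// -(inj_eq val_inj) /= eq_sym inordK//.
    by apply: (allP t7); rewrite mem_nth ?st.
  by congr (_ * _ * _); apply: D => //; apply/val_inj; rewrite /= inordK.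
under eq_bigr => K _ do rewrite phiK mulr_suml.
rewrite exchange_big /=; apply: eq_bigr => t _.
under eq_bigr => K _ do rewrite -mulrA.
rewrite -mulr_sumr; congr (_ * _).
have mv : multilinear (fun u : 'I_3 -> E => @vol0 R (vcat u v)).
  move=> u m a x y.
  have E z : vcat [eta u with m |-> z] v = [eta vcat u v with lshift 4 m |-> z].
    apply/funext => i /=; rewrite /vcat; case: split_ordP => j -> /=.
      by rewrite eq_lshift.
    by rewrite eq_rlshift.
  by rewrite !E multilinear_vol0.
by rewrite [RHS](mform_expand _ mv).
Qed.

Definition psi0 : mform R 4 := fun v =>
  ppsi (coords (v (inord 0))) (coords (v (inord 1))) (coords (v (inord 2)))
    (coords (v (inord 3))).

Lemma multilinear_psi0 : multilinear psi0.
Proof.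
move=> v m a x y; rewrite /psi0.
have mE : m = inord m by rewrite inord_val.
rewrite mE; case: m mE => -[|[|[|[|m]]]] im _ //=;
  rewrite -!(inj_eq val_inj) /= !inordK//= /ppsi /minor4 /minor3 /minor2 !coordsD;
  move: (coords x) (coords y) (coords (v _)) (coords (v _)) (coords (v _)) => ?????; ring.
Qed.

Lemma hodge_psi0 v : @hodge R 3 4 1%:M vol0 phi0 v = psi0 v.
Proof.
move: v; apply: mform_ext.
- move=> v m a x y; rewrite !hodge_phi0.
  have : multilinear (fun v : 'I_4 -> E => 6^-1 *
    \sum_(t <- phi_terms) (-1) ^+ t.1 *
      @vol0 R (vcat (fun m : 'I_3 => ebase (inord (nth 0%N t.2 m))) v)).
    apply: multilinearZ; apply: multilinear_sum => t; apply: multilinearZ.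
    exact: (multilinear_vcatr (k := 3) (l := 4)) multilinear_vol0.
  by apply.
- exact: multilinear_psi0.
move=> f; rewrite hodge_phi0 /psi0 !coords_ebase 4!(pdelta_intr R) ppsi_intr.
apply: (@mulfI _ 6); first by rewrite pnatr_eq0.
rewrite mulVKf ?pnatr_eq0//.
have := psi_int_check (ltn_ord (f (inord 0))) (ltn_ord (f (inord 1)))
  (ltn_ord (f (inord 2))) (ltn_ord (f (inord 3))).
rewrite -sum_foldr => /(congr1 (fun x : int => x%:~R : R)).
rewrite intrM => <-; rewrite rmorph_sum /=; apply: eq_big_seq => t.
move=> /phi_terms_lt[st t7]; rewrite intrM rmorphXn /= rmorphN1; congr (_ * _).
rewrite -vol0_list ?size_cat ?st//; last by rewrite all_cat t7 /= !ltn_ord.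
congr vol0; apply/funext => i; rewrite /vcat; case: split_ordP => j -> /=.
  by rewrite nth_cat st ltn_ord.
rewrite nth_cat st (_ : (3 + j < 3)%N = false) ?addKn//.
by case: j => -[|[|[|[|j]]]] ij//=; rewrite inord_val; congr (ebase (f _));
  apply/val_inj; rewrite /= inordK.
Qed.

Lemma phi_intR i j k : (i < 7)%N -> (j < 7)%N -> (k < 7)%N ->
  pphi (pdelta i) (pdelta j) (pdelta k) = (phi_int i j k)%:~R :> R.
Proof. by move=> *; rewrite 3!(pdelta_intr R) pphi_intr phi_intE. Qed.

Lemma sign_perms_lt n p k : p \in sign_perms n -> (k < n)%N -> (nth 0%N p.2 k < n)%N.
Proof.
elim: n p k => [|n IH] p k//; rewrite sign_permsS.
move=> /allpairsPdep[j [q [jn qn ->]]] /=; rewrite mem_iota /= in jn.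
case: k => [|k]//= kn; rewrite (nth_map 0%N) ?(size_sign_perms qn)//.
have h := IH _ _ qn kn; rewrite /bump; case: (j <= _)%N; first exact: h.
exact: (ltnW h).
Qed.

Lemma contract_phi0E (u : E) (v : nat -> E) : contract u phi0 (fun m => v m) =
  pphi (coords u) (coords (v 0%N)) (coords (v 1%N)).
Proof.
rewrite /Defs.contract (_ : vcons _ _ = vec3 u (v 0%N) (v 1%N)) ?phi0_vec3//.
apply/funext => m; rewrite /vcons /vec3; case: unliftP => [[[|[|n]] ni]|] -> //=.
Qed.

Lemma wedge2_phi0E (i j : 'I_7) (l : seq nat) :
  (forall k, (k < 4)%N -> (nth 0%N l k < 7)%N) ->
  wedge (contract (ebase i) phi0) (contract (ebase j) phi0)
    (fun m => ebase (inord (nth 0%N l m))) = (wedge2_int i j l)%:~R :> R.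
Proof.
move=> l7; rewrite (@wedge_perms R 2 2 _ _ (fun m => ebase (inord (nth 0%N l m)))).
rewrite (_ : 2`! * 2`! = 4)%N//.
pose f (i : nat) p q : R := pphi (pdelta i) (pdelta (nth 0%N l p)) (pdelta (nth 0%N l q)).
transitivity (4^-1 * \sum_(q <- sign_perms 4) (-1) ^+ q.1 *
    (f i (nth 0 q.2 0)%N (nth 0 q.2 1)%N * f j (nth 0 q.2 2)%N (nth 0 q.2 3)%N)).
  congr (_ * _); apply: eq_big_seq => q q4.
  have c7 k : (k < 4)%N -> (nth 0%N l (nth 0%N q.2 k) < 7)%N.
    by move=> k4; apply/l7/(sign_perms_lt q4).
  rewrite (contract_phi0E _ (fun m => ebase (inord (nth 0%N l (nth 0%N q.2 m))))).
  rewrite (contract_phi0E _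
    (fun m => ebase (inord (nth 0%N l (nth 0%N q.2 (2 + m)%N))))).
  by rewrite !coords_ebase !inordK ?c7.
(* Antisymmetry makes the 24 permutations four copies of the six shuffles, which cancels the factor
   1/4. *)
have fC k p q : f k q p = - f k p q.
  by rewrite /f /pphi /minor3 /minor2; ring.
have fE k p q : (k < 7)%N -> (p < 4)%N -> (q < 4)%N ->
    f k p q = (phi_int k (nth 0%N l p) (nth 0%N l q))%:~R.
  by move=> k7 p4 q4; rewrite /f phi_intR// l7.
have tE p q r s : (p < 4)%N -> (q < 4)%N -> (r < 4)%N -> (s < 4)%N ->
    (let c := phi_int i (nth 0%N l p) (nth 0%N l q) in
     if c == 0 then 0 else c * phi_int j (nth 0%N l r) (nth 0%N l s))%:~R =
    f i p q * f j r s.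
  move=> p4 q4 r4 s4; rewrite !fE//=.
  by case: eqP => [->|_]; rewrite ?mul0r// intrM.
rewrite /wedge2_int !(intrD, rmorphN) /= !tE//.
rewrite !big_cons big_nil /= !(fC _ 0%N 1%N) !(fC _ 0%N 2%N) !(fC _ 0%N 3%N)
  !(fC _ 1%N 2%N) !(fC _ 1%N 3%N) !(fC _ 2%N 3%N).
by field.
Qed.

Lemma wedge_phi0_ebase (i j : 'I_7) :
  wedge (wedge (contract (ebase i) phi0) (contract (ebase j) phi0)) phi0 ebase =
  6 * (i == j)%:R :> R.
Proof.
have -> : ebase = (fun m : 'I_7 => (fun k => ebase (inord k)) (m : nat)) :> ('I_7 -> E).
  by apply/funext => m; rewrite inord_val.
rewrite (@wedge_perms R (2 + 2)%N 3 _ _ (fun k => ebase (inord k))).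
set ps := [seq p <- sign_perms 7 | phi_perm_value p != 0].
(* 144 = 4! 3! is the denominator of the outer wedge, and 864 / 144 = 6. *)
transitivity (144^-1 * (wedge3_int ps i j)%:~R : R); last first.
  rewrite wedge3_intE// intrM; set d : R := (i == j)%:R.
  by rewrite (_ : (_ == _)%:R%:~R = d)//; field.
rewrite (_ : (2 + 2)`! * 3`! = 144)%N//; congr (_ * _).
rewrite /wedge3_int -sum_foldr rmorph_sum big_filter [RHS]big_mkcond.
apply: eq_big_seq => p p7.
have c7 k : (k < 7)%N -> (nth 0%N p.2 k < 7)%N by exact: (sign_perms_lt p7).
rewrite wedge2_phi0E; last by move=> k k4; apply: c7; rewrite (leq_trans k4).
rewrite (phi0E (fun m => ebase (inord (nth 0%N p.2 (2 + 2 + m)%N)))).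
rewrite !coords_ebase !inordK ?c7// phi_intR ?c7// -/(phi_perm_value p).
case: eqP => [->|_]; first by rewrite !mulr0.
by rewrite !rmorphM rmorphXn /= rmorphN1.
Qed.

Lemma wedge_linearl k l (c : R) (a a' : mform R k) (b : mform R l) v :
  wedge (fun v => c * a v + a' v) b v = c * wedge a b v + wedge a' b v.
Proof.
rewrite /wedge mulrCA -mulrDr; congr (_ * _); rewrite mulr_sumr -big_split.
have E (e x y z : R) : e * ((c * x + y) * z) = c * (e * (x * z)) + e * (y * z) by ring.
by apply: eq_bigr => s _; exact: E.
Qed.

Lemma wedge_linearr k l (c : R) (a : mform R k) (b b' : mform R l) v :
  wedge a (fun v => c * b v + b' v) v = c * wedge a b v + wedge a b' v.
Proof.
rewrite /wedge mulrCA -mulrDr; congr (_ * _); rewrite mulr_sumr -big_split.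
have E (e x y z : R) : e * (z * (c * x + y)) = c * (e * (z * x)) + e * (z * y) by ring.
by apply: eq_bigr => s _; exact: E.
Qed.

Lemma ip1E (u v : E) : ip 1%:M u v = \sum_k u 0 k * v 0 k.
Proof. by rewrite /ip mulmx1 mxE; apply: eq_bigr => k _; rewrite mxE. Qed.

(** Shows that phi0 induces the Euclidean metric and the determinant. The left side has top degree
    in w and is bilinear in u and v, so only basis vectors remain to be checked. *)
Lemma wedge_phi0 (u v : E) (w : 'I_7 -> E) :
  wedge (wedge (contract u phi0) (contract v phi0)) phi0 w =
  6 * (ip 1%:M u v * vol0 w).
Proof.
have mc x := multilinear_contract x (@multilinear_phi0 R).
have mw (x y : E) := multilinear_wedge (mc x) (mc y).
have mW x y := multilinear_wedge (mw x y) (@multilinear_phi0 R).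
rewrite (top_formE w (mW u v) (@alternating_wedge _ (2 + 2) 3 _ _)).
rewrite mulrA [RHS]mulrC; congr (_ * _).
pose A x y : R := wedge (wedge (contract x phi0) (contract y phi0)) phi0 ebase.
have cl a (x y : E) : contract (a *: x + y) phi0 =
    (fun v => a * contract x phi0 v + contract y phi0 v).
  by apply/funext => v'; rewrite contract_linear//; exact: multilinear_phi0.
have Al y a x x' : A (a *: x + x') y = a * A x y + A x' y.
  rewrite /A cl -wedge_linearl; congr (wedge _ _ _).
  by apply/funext => v'; rewrite wedge_linearl.
have Ar x a y y' : A x (a *: y + y') = a * A x y + A x y'.
  rewrite /A cl -wedge_linearl; congr (wedge _ _ _).
  by apply/funext => v'; rewrite wedge_linearr.
rewrite -[LHS]/(A u v) (scalar_row_sum u (Al v)) ip1E mulr_sumr.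
apply: eq_bigr => i _; rewrite (scalar_row_sum v (Ar _)) mulrCA; congr (_ * _).
rewrite (bigD1 i)//= /A wedge_phi0_ebase eqxx big1 ?addr0 => [|j ji].
  by rewrite mulr1 mulrC.
by rewrite wedge_phi0_ebase eq_sym (negbTE ji) !mulr0.
Qed.

End StandardStructure.

(** * Adapted frames *)

Section Frames.
Context {R : realType}.
Local Notation E := ('rV[R]_7).

Definition pullback k (F : 'M[R]_7) (w : mform R k) : mform R k :=
  fun v => w (fun m => v m *m F).

Lemma pullback_mul k (F Q : 'M[R]_7) (w : mform R k) :
  pullback (F *m Q) w = pullback F (pullback Q w).
Proof.
by apply/funext => v; congr w; apply/funext => m; rewrite mulmxA.
Qed.

Lemma alternating_pullback k F (w : mform R k) :
  alternating w -> alternating (pullback F w).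
Proof. by move=> aw v m n mn vmn; apply: (aw _ m n mn); rewrite vmn. Qed.

Lemma ip_frame (F : 'M[R]_7) (u v : E) :
  ip (F *m F^T) u v = ip 1%:M (u *m F) (v *m F).
Proof. by rewrite /ip trmx_mul mulmx1 !mulmxA. Qed.

Lemma ip_ebase (G : 'M[R]_7) i j : ip G (ebase i) (ebase j) = G i j.
Proof. by rewrite /ip /ebase -rowE trmx_delta -colE !mxE. Qed.

Lemma ip1_gt0 (u : E) : u != 0 -> 0 < ip 1%:M u u.
Proof.
move=> u0; rewrite ip1E; have [k uk] : exists k, u 0 k != 0.
  apply/existsP; apply: contraR u0; rewrite negb_exists => /forallP u0.
  by apply/eqP/rowP => k; rewrite mxE; apply/eqP; rewrite -[_ == _]negbK.
rewrite (bigD1 k)//= ltr_pwDl// -?expr2 ?exprn_even_gt0//.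
by apply: sumr_ge0 => j _; rewrite -expr2 sqr_ge0.
Qed.

Lemma frame_volume_form (F : 'M[R]_7) :
  volume_form (F *m F^T) (pullback F vol0).
Proof.
split; first exact: multilinear_comp multilinear_vol0.
  exact: alternating_pullback alternating_vol0.
move=> e oe; rewrite /pullback /vol0.
set A := \matrix_i _; have : A *m A^T = 1%:M.
  apply/matrixP => i j; rewrite !mxE -oe ip_frame ip1E.
  by apply: eq_bigr => k _; rewrite !mxE.
move=> /(congr1 determinant); rewrite det_mulmx det_tr det1 => /eqP.
by rewrite -expr2 sqrf_eq1 => /orP[] /eqP ->; rewrite ?normrN normr1.
Qed.

Lemma frame_associated (F : 'M[R]_7) : F \in unitmx ->
  associated_metric_at (pullback F phi0) (F *m F^T) (pullback F vol0).
Proof.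
move=> uF; split; last 1 first.
- move=> u v w; rewrite ip_frame.
  have -> : wedge (wedge (contract u (pullback F phi0)) (contract v (pullback F phi0)))
      (pullback F phi0) w = wedge (wedge (contract (u *m F) phi0)
        (contract (v *m F) phi0)) phi0 (fun m => w m *m F).
    by rewrite /pullback !contract_comp.
  by rewrite wedge_phi0 mulKf ?pnatr_eq0.
- split; first by rewrite trmx_mul trmxK.
  move=> u u0; rewrite ip_frame; apply: ip1_gt0.
  by apply: contraNneq u0 => uF0; rewrite -(mulmxK uF u) uF0 mul0mx.
- exact: frame_volume_form.
Qed.

(* Two unit volume forms differ by a factor k, so k times the metric is F F^T;
   rescaling an orthonormal basis by sqrt k then gives (sqrt k)^9 = 1. *)
Lemma frame_associated_unique (F G : 'M[R]_7) vol : F \in unitmx ->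
  associated_metric_at (pullback F phi0) G vol ->
  G = F *m F^T /\ vol = pullback F vol0.
Proof.
move=> uF [[sG pG] [mv av nv] aG].
have [[_ pG0] [mv0 av0 _] aG0] := frame_associated uF.
pose e m : E := ebase m *m invmx F.
have volE w : vol w = pullback F vol0 w * vol e.
  have vF : pullback (invmx F) vol (fun m => w m *m F) = vol w.
    by congr vol; apply/funext => m; rewrite mulmxK.
  have mvF : multilinear (pullback (invmx F) vol) := multilinear_comp (invmx F) mv.
  by rewrite -vF (top_formE _ mvF (alternating_pullback (invmx F) av)).
have vol0e : pullback F vol0 e = 1.
  by rewrite -vol0_ebase; congr vol0; apply/funext => m; rewrite mulmxKV.
set k := vol e in volE.
have GE u v : ip (F *m F^T) u v = k * ip G u v.
  by have := aG u v e; rewrite -aG0 vol0e mulr1 mulrC => <-.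
have e0 : e ord0 != 0.
  apply: contraTneq isT => e0; have := ip_ebase 1%:M ord0 ord0.
  rewrite -[ebase ord0](mulmxKV uF) -/(e ord0) e0 mul0mx /ip !mul0mx !mxE.
  by move=> /eqP; rewrite eq_sym oner_eq0.
have k0 : 0 < k.
  by have := pG0 _ e0; rewrite GE pmulr_lgt0// pG.
pose s := Num.sqrt k; have s0 : 0 < s by rewrite sqrtr_gt0.
have ks : k = s ^+ 2 by rewrite sqr_sqrtr ?ltW.
have ipZ a b u v : ip G (a *: u) (b *: v) = a * b * ip G u v.
  by rewrite /ip linearZ /= -!scalemxAl -scalemxAr scalerA mxE.
have s1 : s = 1.
  have : `|vol (fun m => s *: e m)| = 1.
    apply: nv => m n; rewrite ipZ -expr2 -ks -GE ip_frame !mulmxKV//.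
    by rewrite ip_ebase mxE.
  rewrite volE (_ : pullback _ _ _ = s ^+ 7); last first.
    rewrite /pullback /vol0 (_ : \matrix_i _ = s *: 1%:M) ?detZ ?det1 ?mulr1//.
    apply/row_matrixP => i; rewrite rowK linearZ /= row1 -scalemxAl.
    by rewrite mulmxKV.
  rewrite ks -exprD ger0_norm ?exprn_ge0 ?ltW// => /eqP.
  by rewrite pexpr_eq1 ?ltW// => /eqP.
have k1 : k = 1 by rewrite ks s1 expr1n.
split; last by apply/funext => w; rewrite volE k1 mulr1.
by apply/matrixP => i j; rewrite -ip_ebase -[RHS]ip_ebase GE k1 mul1r.
Qed.

(** Linearity written out over the seven coordinates, so that [ring] proves it for a concrete f;
    [mx7 f] then acts as f on coordinates. *)
Definition linear7 (f : (nat -> R) -> nat -> R) : Prop :=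
  forall x n, (n < 7)%N ->
    f x n = x 0%N * f (pdelta 0) n + x 1%N * f (pdelta 1) n
      + x 2%N * f (pdelta 2) n + x 3%N * f (pdelta 3) n + x 4%N * f (pdelta 4) n
      + x 5%N * f (pdelta 5) n + x 6%N * f (pdelta 6) n.

Definition mx7 (f : (nat -> R) -> nat -> R) : 'M[R]_7 :=
  \matrix_(k, n) f (pdelta k) n.

Lemma coords_mx7 f x n : linear7 f -> (n < 7)%N ->
  coords (x *m mx7 f) n = f (coords x) n.
Proof.
move=> lf n7; rewrite lf// {1}/coords n7 mxE sum7.
by rewrite !mxE !inordK// /coords /=.
Qed.

Lemma pphi_ext (x x' y y' z z' : nat -> R) :
  (forall n, (n < 7)%N -> x n = x' n) -> (forall n, (n < 7)%N -> y n = y' n) ->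
  (forall n, (n < 7)%N -> z n = z' n) -> pphi x y z = pphi x' y' z'.
Proof.
move=> xx yy zz; rewrite /pphi /minor3 /minor2.
by rewrite !xx// !yy// !zz.
Qed.

Lemma pullback_mx7 f : linear7 f ->
  (forall x y z, pphi (f x) (f y) (f z) = pphi x y z) ->
  pullback (mx7 f) phi0 = phi0.
Proof.
move=> lf pf; apply/funext => v; rewrite /pullback [X in phi0 X]vec3_eta.
rewrite [in RHS](vec3_eta v) !phi0_vec3 -[RHS]pf.
by apply: pphi_ext => n n7; rewrite coords_mx7.
Qed.

Lemma mx7_unit f h : linear7 f -> linear7 h ->
  (forall x n, (n < 7)%N -> h (f x) n = x n) ->
  (forall x y n, (forall k, (k < 7)%N -> x k = y k) -> (n < 7)%N -> h x n = h y n) ->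
  mx7 f \in unitmx.
Proof.
move=> lf lh hf hext.
have fh : mx7 f *m mx7 h = 1%:M.
  apply/row_matrixP => i; rewrite rowE mulmxA row1 -/(ebase i).
  apply: coordsP => n n7; rewrite coords_mx7// -[RHS](hf (coords (ebase i)))//.
  by apply: hext => // k k7; rewrite coords_mx7.
by have [] := mulmx1_unit fh.
Qed.

(* Rotation in the planes (i, j) and (l, m), by angles with the same cosine c
   and with sines s and t. *)
Definition rot4 (i j l m : nat) (c s t : R) (x : nat -> R) (n : nat) : R :=
  if n == i then c * x i + s * x j else
  if n == j then c * x j - s * x i else
  if n == l then c * x l + t * x m else
  if n == m then c * x m - t * x l else x n.

(** Turning a single coordinate plane does not preserve phi0, but two suitable planes turned
    together do, by the same angle (e = 1) or by opposite angles (e = -1). Replacing s by -s gives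
    the inverse. *)
Definition G2_rotation (i j l m : nat) (e : R) : Prop :=
  forall c s : R, c * c = 1 - s * s ->
  [/\ linear7 (rot4 i j l m c s (e * s)),
      forall x n, (n < 7)%N ->
        rot4 i j l m c (- s) (e * - s) (rot4 i j l m c s (e * s) x) n = x n &
      forall x y z, pphi (rot4 i j l m c s (e * s) x) (rot4 i j l m c s (e * s) y)
        (rot4 i j l m c s (e * s) z) = pphi x y z].

Ltac G2_rot := let cs := fresh "cs" in intros c s cs; split;
  [ by move=> x [|[|[|[|[|[|[|n]]]]]]]//= _; rewrite /rot4 /pdelta /=; ring
  | by move=> x [|[|[|[|[|[|[|n]]]]]]]//= _; rewrite /rot4 /=; ring: cs
  | by move=> x y z; rewrite /pphi /minor3 /minor2 /rot4 /=; ring: cs].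

Lemma rot_5634 : G2_rotation 5 6 3 4 (-1). Proof. G2_rot. Qed.
Lemma rot_3412 : G2_rotation 3 4 1 2 (-1). Proof. G2_rot. Qed.
Lemma rot_3546 : G2_rotation 3 5 4 6 1. Proof. G2_rot. Qed.
Lemma rot_1256 : G2_rotation 1 2 5 6 (-1). Proof. G2_rot. Qed.
Lemma rot_1324 : G2_rotation 1 3 2 4 1. Proof. G2_rot. Qed.
Lemma rot_0136 : G2_rotation 0 1 3 6 1. Proof. G2_rot. Qed.

Lemma rot4_ext i j l m c s t x y n : (i < 7)%N -> (j < 7)%N -> (l < 7)%N ->
  (m < 7)%N -> (forall k, (k < 7)%N -> x k = y k) -> (n < 7)%N ->
  rot4 i j l m c s t x n = rot4 i j l m c s t y n.
Proof. by move=> i7 j7 l7 m7 xy n7; rewrite /rot4 !xy. Qed.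

Definition G2_matrix (Q : 'M[R]_7) := Q \in unitmx /\ pullback Q phi0 = phi0.

Lemma G2_matrix_mul P Q : G2_matrix P -> G2_matrix Q -> G2_matrix (P *m Q).
Proof.
move=> [uP pP] [uQ pQ]; split; first by rewrite unitmx_mul uP.
by rewrite pullback_mul pQ.
Qed.

Lemma G2_givens i j l m e (u : E) : G2_rotation i j l m e ->
  (i < 7)%N -> (j < 7)%N -> (l < 7)%N -> (m < 7)%N -> i != j ->
  exists Q c s t, [/\ G2_matrix Q, coords (u *m Q) j = 0 &
    forall n, (n < 7)%N -> coords (u *m Q) n = rot4 i j l m c s t (coords u) n].
Proof.
move=> rP i7 j7 l7 m7 ij; set a := coords u i; set b := coords u j.
(* The pair (c, s) is (a, b) normalised, which kills coordinate j; if a = b = 0, the identity will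
   do. *)
have [c [s [cs cb]]] : exists c s : R, c * c = 1 - s * s /\ c * b - s * a = 0.
  have [ab0|ab0] := eqVneq (a ^+ 2 + b ^+ 2) 0.
    exists 1, 0; move: ab0 => /eqP; rewrite paddr_eq0 ?sqr_ge0//.
    by rewrite !sqrf_eq0 => /andP[_ /eqP ->]; split; ring.
  pose r := Num.sqrt (a ^+ 2 + b ^+ 2).
  have rr : r * r = a ^+ 2 + b ^+ 2.
    by rewrite -expr2 sqr_sqrtr// addr_ge0 ?sqr_ge0.
  have r0 : r != 0 by apply: contraNneq ab0 => r0; rewrite -rr r0 mulr0.
  exists (a / r), (b / r); split; last by field.
  have aE : a ^+ 2 = r * r - b ^+ 2 by rewrite rr addrK.
  apply: (mulfI (mulf_neq0 r0 r0)).
  rewrite (_ : r * r * (a / r * (a / r)) = a ^+ 2); last by field.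
  by rewrite aE; field.
have [lr kr pr] := rP c s cs.
have cs' : c * c = 1 - - s * - s by rewrite mulrNN.
have [lr' _ _] := rP c (- s) cs'.
exists (mx7 (rot4 i j l m c s (e * s))), c, s, (e * s); split.
- split; last exact: pullback_mx7.
  apply: (mx7_unit lr lr' kr) => x y n xy n7.
  exact: rot4_ext.
- by rewrite coords_mx7// /rot4 eqxx eq_sym (negbTE ij).
- by move=> n n7; rewrite coords_mx7.
Qed.

(* Each rotation kills one more coordinate: 7, 5, 6, 3, 4 and finally 2. *)
Lemma G2_transitive (u : E) : exists2 Q, G2_matrix Q &
  forall n, (0 < n < 7)%N -> coords (u *m Q) n = 0.
Proof.
have [Q1 [c1 [s1 [t1 [g1 z1 r1]]]]] := G2_givens u rot_5634 isT isT isT isT isT.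
have [Q2 [c2 [s2 [t2 [g2 z2 r2]]]]] :=
  G2_givens (u *m Q1) rot_3412 isT isT isT isT isT.
have [Q3 [c3 [s3 [t3 [g3 z3 r3]]]]] :=
  G2_givens (u *m Q1 *m Q2) rot_3546 isT isT isT isT isT.
have [Q4 [c4 [s4 [t4 [g4 z4 r4]]]]] :=
  G2_givens (u *m Q1 *m Q2 *m Q3) rot_1256 isT isT isT isT isT.
have [Q5 [c5 [s5 [t5 [g5 z5 r5]]]]] :=
  G2_givens (u *m Q1 *m Q2 *m Q3 *m Q4) rot_1324 isT isT isT isT isT.
have [Q6 [c6 [s6 [t6 [g6 z6 r6]]]]] :=
  G2_givens (u *m Q1 *m Q2 *m Q3 *m Q4 *m Q5) rot_0136 isT isT isT isT isT.
exists (Q1 *m Q2 *m Q3 *m Q4 *m Q5 *m Q6); first by do !apply: G2_matrix_mul.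
rewrite !mulmxA.
have y6 : coords (u *m Q1 *m Q2) 6 = 0 by rewrite r2.
have w6 : coords (u *m Q1 *m Q2 *m Q3) 6 = 0.
  by rewrite r3// /rot4 /= y6 z2; ring.
have w4 : coords (u *m Q1 *m Q2 *m Q3) 4 = 0.
  by rewrite r3// /rot4 /= y6 z2; ring.
have a5 : coords (u *m Q1 *m Q2 *m Q3 *m Q4) 5 = 0.
  by rewrite r4// /rot4 /= w6 z3; ring.
have a6 : coords (u *m Q1 *m Q2 *m Q3 *m Q4) 6 = 0.
  by rewrite r4// /rot4 /= w6 z3; ring.
have a4 : coords (u *m Q1 *m Q2 *m Q3 *m Q4) 4 = 0 by rewrite r4.
have b2 : coords (u *m Q1 *m Q2 *m Q3 *m Q4 *m Q5) 2 = 0.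
  by rewrite r5// /rot4 /= z4 a4; ring.
have b4 : coords (u *m Q1 *m Q2 *m Q3 *m Q4 *m Q5) 4 = 0.
  by rewrite r5// /rot4 /= z4 a4; ring.
have b5 : coords (u *m Q1 *m Q2 *m Q3 *m Q4 *m Q5) 5 = 0 by rewrite r5.
have b6 : coords (u *m Q1 *m Q2 *m Q3 *m Q4 *m Q5) 6 = 0 by rewrite r5.
case=> [|[|[|[|[|[|[|n]]]]]]]//= _; rewrite ?z6// r6// /rot4 /= ?b2 ?b4 ?b5//;
  by rewrite z5 b6; ring.
Qed.

Lemma positive_frame (phi : mform R 3) (al : E) : positive_form phi ->
  exists F, [/\ F \in unitmx, phi = pullback F phi0 &
    forall n, (0 < n < 7)%N -> coords (al *m F) n = 0].
Proof.
move=> [F0 uF0 pF0]; have [Q [uQ pQ] zQ] := G2_transitive (al *m F0).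
exists (F0 *m Q); split; first by rewrite unitmx_mul uF0.
- by rewrite pullback_mul pQ; apply/funext => v; rewrite pF0.
- by move=> n /zQ; rewrite mulmxA.
Qed.

End Frames.

(** * Polynomial identities for the variation of sigma_V(phi) *)

Section VariationPolynomials.
Context {R : comNzRingType}.
Implicit Types x y z w : nat -> R.

Definition padd x y : nat -> R := fun k => x k + y k.
Definition pscal (c : R) x : nat -> R := fun k => c * x k.
Definition pe1 (b : R) : nat -> R := fun k => if k is 0 then b else 0.

Lemma ppsi_cross x y z w : ppsi x y z w =
  pdot (pcross x y) (pcross z w) - pdot x z * pdot y w + pdot x w * pdot y z.
Proof. rewrite /pdot /pcross /ppsi /minor4 /minor3 /minor2; ring. Qed.

(* |V|^2 times the Hodge dual of sigma_V(phi0), for V = (a, b e_1). *)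
Definition psihat (a b : R) x y z w : R :=
  (a * a + b * b) * (minor4 3 4 5 6 x y z w + minor4 1 2 5 6 x y z w
    + minor4 1 2 3 4 x y z w)
  + (a * a - b * b) * (minor4 0 2 4 6 x y z w - minor4 0 2 3 5 x y z w
    - minor4 0 1 4 5 x y z w - minor4 0 1 3 6 x y z w)
  + 2 * a * b * (minor4 0 1 3 5 x y z w - minor4 0 1 4 6 x y z w
    - minor4 0 2 4 5 x y z w - minor4 0 2 3 6 x y z w).

(* Im ((V tau) conj V) *)
Definition pAd (a b : R) (tau : nat -> R) : nat -> R :=
  let A := padd (pscal a tau) (pcross (pe1 b) tau) in
  padd (padd (pscal (pdot (pe1 b) tau) (pe1 b)) (pscal a A))
    (pscal (-1) (pcross A (pe1 b))).

(* Im (V conj V') for V' = (a', b') *)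
Definition pVdV (a b : R) (a' : R) (b' : nat -> R) : nat -> R :=
  padd (padd (pscal (- a) b') (pscal a' (pe1 b))) (pscal (-1) (pcross (pe1 b) b')).

(** The part of the variation due to the torsion of phi, with V held parallel and denominators
    cleared by |V|^4. The terms with [pcross] are the variation of psi, obtained by varying both
    cross products in [ppsi_cross]. *)
Lemma torsion_variation a b tau x y z : let al := pe1 b in
  (a * a + b * b) * ((a * a - b * b) * 2 * ppsi tau x y z
    - 2 * a * (2 * (ppsi tau al x (pcross y z) + ppsi tau y z (pcross al x)))
    + 2 * (pdot al x * (2 * ppsi tau al y z) - pdot al y * (2 * ppsi tau al x z)
      + pdot al z * (2 * ppsi tau al x y))) =
  2 * psihat a b (pAd a b tau) x y z.
Proof.
rewrite /pAd /psihat /padd /pscal /pe1 /pdot /pcross.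
rewrite /ppsi /minor4 /minor3 /minor2; ring.
Qed.

(** The part due to V, with phi held parallel: the left side is the numerator of the quotient rule
    for sigma_V(phi), whose denominator is |V|^2. *)
Lemma section_variation a b a' b' x y z : let al := pe1 b in
  (a * a + b * b) * ((2 * a * a' - 2 * pdot b' al) * pphi x y z
    - 2 * a' * ppsi al x y z - 2 * a * ppsi b' x y z
    + 2 * (pdot b' x * pphi al y z - pdot b' y * pphi al x z + pdot b' z * pphi al x y
      + pdot al x * pphi b' y z - pdot al y * pphi b' x z + pdot al z * pphi b' x y))
  - (2 * a * a' + 2 * pdot b' al) *
    ((a * a - b * b) * pphi x y z - 2 * a * ppsi al x y z
     + 2 * (pdot al x * pphi al y z - pdot al y * pphi al x z
       + pdot al z * pphi al x y)) =
  2 * psihat a b (pVdV a b a' b') x y z.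
Proof.
rewrite /pVdV /psihat /padd /pscal /pe1 /pdot /pcross /pphi.
rewrite /ppsi /minor4 /minor3 /minor2; ring.
Qed.

End VariationPolynomials.

Section FrameFormulas.
Context {R : realType}.
Local Notation E := ('rV[R]_7).

Lemma coords_lin a (x y : E) :
  coords (a *: x + y) = padd (pscal a (coords x)) (coords y).
Proof. by apply/funext => k; rewrite coordsD. Qed.

Lemma coordsA (x y : E) : coords (x + y) = padd (coords x) (coords y).
Proof.
rewrite -[x]scale1r coords_lin; apply/funext => k.
by rewrite /padd /pscal mul1r scale1r.
Qed.

Lemma coordsN (x : E) : coords (- x) = pscal (-1) (coords x).
Proof.
by apply/funext => k; rewrite -[- x]addr0 -scaleN1r coordsD /pscal /coords mxE;
  case: ifP; rewrite addr0.
Qed.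

Lemma coordsZ a (x : E) : coords (a *: x) = pscal a (coords x).
Proof.
by apply/funext => k; rewrite -[a *: x]addr0 coordsD /pscal /coords mxE;
  case: ifP; rewrite addr0.
Qed.

Lemma ip1_coords (u v : E) : ip 1%:M u v = pdot (coords u) (coords v).
Proof. by rewrite ip1E sum7 /pdot /coords. Qed.

Lemma ip_coords F (u v : E) :
  ip (F *m F^T) u v = pdot (coords (u *m F)) (coords (v *m F)).
Proof. by rewrite ip_frame ip1_coords. Qed.

Lemma pullback_vec3 F (x y z : E) : pullback F phi0 (vec3 x y z) =
  pphi (coords (x *m F)) (coords (y *m F)) (coords (z *m F)).
Proof.
rewrite -phi0_vec3; congr phi0; apply/funext => m.
by case: m => -[|[|[|m]]].
Qed.

Lemma frame_unit (F : 'M[R]_7) : F \in unitmx -> F *m F^T \in unitmx.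
Proof. by move=> uF; rewrite unitmx_mul unitmx_tr uF. Qed.

Lemma multilinear_pullback k (F : 'M[R]_7) (w : mform R k) :
  multilinear w -> multilinear (pullback F w).
Proof. exact: multilinear_comp. Qed.

Lemma cross_coords F (x y : E) : F \in unitmx ->
  coords (cross (F *m F^T) (pullback F phi0) x y *m F) =
  pcross (coords (x *m F)) (coords (y *m F)).
Proof.
move=> uF; apply/funext => n; case: (ltnP n 7) => [n7|n7]; last first.
  rewrite /coords ltnNge n7 /=; do 7![case: n n7 => //= n n7].
have := crossP x y (ebase (inord n) *m invmx F) (frame_unit uF)
  (multilinear_pullback F (@multilinear_phi0 R)).
rewrite ip_coords pullback_vec3 mulmxKV// coords_ebase inordK//.
move: (coords _) (coords _) (coords _) => u v w.
have -> : pphi v u (pdelta n) = pcross v u n.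
  rewrite /pphi /minor3 /minor2 /pcross /pdelta.
  by do 7?[case: n n7 => [|n] n7 /=; first by rewrite /minor2; ring].
move=> <-; rewrite /pdot /pdelta.
by do 7?[case: n n7 => [|n] n7 /=; first by ring].
Qed.

Lemma psi_frame F v : F \in unitmx ->
  psi_of (F *m F^T) (pullback F vol0) (pullback F phi0) v =
  psi0 (fun m => v m *m F) :> R.
Proof.
move=> uF; rewrite -hodge_psi0 /psi_of.
rewrite (@hodge_frame R 3 4 F (pullback F vol0) (pullback F phi0) v uF
  (multilinear_pullback F (@multilinear_phi0 R))
  (multilinear_pullback F (@multilinear_vol0 R))).
have := @hodge_frame R 3 4 1%:M vol0 phi0 (fun m => v m *m F) (unitmx1 _ _)
  (@multilinear_phi0 R) (@multilinear_vol0 R).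
rewrite trmx1 mulmx1 => ->; congr (_ * _); apply: eq_bigr => K _.
rewrite /pullback; congr (phi0 _ * vol0 _); apply/funext => m.
  by rewrite mulmxKV// invmx1 mulmx1.
by rewrite /vcat; case: fintype.split => // i; rewrite mulmxKV// invmx1 mulmx1.
Qed.

Lemma psi_coords F (w x y z : E) : F \in unitmx ->
  contract w (psi_of (F *m F^T) (pullback F vol0) (pullback F phi0)) (vec3 x y z) =
  ppsi (coords (w *m F)) (coords (x *m F)) (coords (y *m F)) (coords (z *m F)).
Proof.
move=> uF; rewrite /Defs.contract psi_frame// /psi0.
have E4 (m : nat) (m4 : (m < 4)%N) : vcons w (vec3 x y z) (inord m : 'I_4) =
    nth 0 [:: w; x; y; z] m.
  rewrite /vcons; case: unliftP => [n|] /(congr1 val); rewrite /= inordK// => ->//.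
by rewrite !E4.
Qed.

Lemma wedge_flat_contract F (al x y z : E) :
  wedge (flat (F *m F^T) al) (contract al (pullback F phi0)) (vec3 x y z) =
  let i := ip (F *m F^T) in let f u v w := pullback F phi0 (vec3 u v w) in
  i al x * f al y z - i al y * f al x z + i al z * f al x y.
Proof.
rewrite /= -/(nth 0 [:: x; y; z]) (@wedge_perms R 1 2 _ _ (nth 0 [:: x; y; z])).
have cE (v : nat -> E) : contract al (pullback F phi0) (fun m => v m) =
    pullback F phi0 (vec3 al (v 0%N) (v 1%N)).
  congr (pullback F phi0 _).
  by apply/funext => m; rewrite /vcons /vec3; case: unliftP => [[[|[|[|n]]] ni]|] ->.
under eq_bigr => p _ do
  rewrite (cE (fun m => nth 0 [:: x; y; z] (nth 0%N p.2 (1 + m)%N))).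
rewrite /= !big_cons big_nil /= /flat /= (_ : 1`! * 2`! = 2)%N//.
rewrite !pullback_vec3 !ip_coords.
move: (coords _) (coords _) (coords _) (coords _) => X Y Z A.
by rewrite /pphi /minor3 /minor2; field.
Qed.

End FrameFormulas.

(** * The form sigma_V(phi) in an adapted frame *)

Section SigmaFrame.
Context {R : realType}.
Local Notation E := ('rV[R]_7).

(* The indices 7 and 8 are out of range: this rotates a single plane. *)
Definition rot12 (c s : R) : (nat -> R) -> nat -> R := rot4 1 2 7 8 c s 0.

Lemma linear7_rot12 c s : linear7 (rot12 c s).
Proof.
by move=> x [|[|[|[|[|[|[|n]]]]]]]//= _; rewrite /rot12 /rot4 /pdelta /=; ring.
Qed.

Lemma coords_rot12 x c s n : (n < 7)%N ->
  coords (x *m mx7 (rot12 c s)) n = rot12 c s (coords x) n.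
Proof. by move=> n7; rewrite coords_mx7//; exact: linear7_rot12. Qed.

Lemma rot12_orthogonal c s : c * c = 1 - s * s ->
  mx7 (rot12 c s) *m (mx7 (rot12 c s))^T = 1%:M.
Proof.
move=> cs; apply/matrixP => i j; rewrite -ip_ebase ip_coords -[RHS]ip_ebase ip1_coords.
rewrite /pdot !coords_rot12//; move: (coords _) (coords _) => x y.
by rewrite /rot12 /rot4 /=; ring: cs.
Qed.

Lemma orthogonal_det2 (Q : 'M[R]_7) : Q *m Q^T = 1%:M -> \det Q * \det Q = 1.
Proof. by move=> /(congr1 determinant); rewrite det_mulmx det_tr det1. Qed.

(* The rotation is the square of the one by half the angle. *)
Lemma rot12_double c s : c * c = 1 - s * s ->
  mx7 (rot12 (c * c - s * s) (2 * c * s)) = mx7 (rot12 c s) *m mx7 (rot12 c s).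
Proof.
move=> cs; apply/row_matrixP => i; rewrite !rowE mulmxA; apply: coordsP => n n7.
rewrite coords_rot12// [in RHS]coords_rot12//.
by case: n n7 => [|[|[|[|[|[|[|n]]]]]]]//= _;
  rewrite /rot12 /rot4 /= !coords_rot12// /rot12 /rot4 /=; ring.
Qed.

Lemma pullback_vol0 (F Q : 'M[R]_7) : \det Q = 1 ->
  pullback (F *m Q) vol0 = pullback F vol0.
Proof.
move=> dQ; apply/funext => v; rewrite /pullback /vol0.
rewrite -[RHS]mulr1 -dQ -det_mulmx; congr (\det _); apply/row_matrixP => i.
by rewrite row_mul !rowK mulmxA.
Qed.

(** sigma_V is quadratic in V: its coefficients (a^2 - b^2)/N and 2ab/N are the cosine and sine of
    twice the angle of (a, b), so Q turns by the double angle. The last clause identifies [psihat]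
    as N times the dual form in the turned frame. *)
Lemma sigma_frame F a (al : E) b : F \in unitmx ->
  coords (al *m F) = pe1 b -> a * a + b * b != 0 ->
  exists Q : 'M[R]_7, [/\ Q *m Q^T = 1%:M, \det Q = 1,
    sigma_at (F *m F^T) (pullback F vol0) (pullback F phi0) (a, al) =
      pullback (F *m Q) phi0 &
    forall w x y z : E, (a * a + b * b) *
      ppsi (coords (w *m (F *m Q))) (coords (x *m (F *m Q)))
        (coords (y *m (F *m Q))) (coords (z *m (F *m Q))) =
      psihat a b (coords (w *m F)) (coords (x *m F)) (coords (y *m F))
        (coords (z *m F))].
Proof.
move=> uF alE N0; set N := a * a + b * b in N0.
have NE : N = a * a + b * b by [].
have Ngt0 : 0 < N by rewrite lt_def N0 /N -!expr2 addr_ge0 ?sqr_ge0.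
pose r := Num.sqrt N; have rr : r * r = N by rewrite -expr2 sqr_sqrtr ?ltW.
have r0 : r != 0 by rewrite gt_eqF// sqrtr_gt0.
pose c := a / r; pose s := b / r.
have cs : c * c = 1 - s * s.
  rewrite /c /s; apply: (mulfI (mulf_neq0 r0 r0)).
  rewrite (_ : r * r * (a / r * (a / r)) = a * a); last by field.
  rewrite (_ : r * r * (1 - b / r * (b / r)) = r * r - b * b); last by field.
  by rewrite rr NE; ring.
have CE : c * c - s * s = (a * a - b * b) / N by rewrite /c /s -rr; field.
have SE : 2 * c * s = 2 * a * b / N by rewrite /c /s -rr; field.
have cs2 : (c * c - s * s) * (c * c - s * s) = 1 - (2 * c * s) * (2 * c * s).
  by rewrite cs; ring: cs.
exists (mx7 (rot12 (c * c - s * s) (2 * c * s))).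
have coordsQ (x : E) n : (n < 7)%N ->
    coords (x *m (F *m mx7 (rot12 (c * c - s * s) (2 * c * s)))) n =
    rot12 ((a * a - b * b) / N) (2 * a * b / N) (coords (x *m F)) n.
  by move=> n7; rewrite mulmxA coords_rot12// CE SE.
split.
- exact: rot12_orthogonal.
(* Q is the square of an orthogonal matrix, whose determinant squares to 1; this preserves the
   orientation. *)
- by rewrite rot12_double// det_mulmx; apply/orthogonal_det2/rot12_orthogonal.
- apply/funext => v; rewrite (vec3_eta v).
  move: (v _) (v _) (v _) => z y x.
  rewrite pullback_vec3 (pphi_ext (coordsQ x) (coordsQ y) (coordsQ z)).
  rewrite /sigma_at /oct_norm2 /oct_ip /= wedge_flat_contract psi_coords//=.
  rewrite !pullback_vec3 !ip_coords alE.
  move: (coords _) (coords _) (coords _) => X Y Z.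
  have -> : pdot (pe1 b) (pe1 b) = b * b by rewrite /pdot /=; ring.
  rewrite /pphi /ppsi /minor4 /minor3 /minor2 /rot12 /rot4 /pe1 /pdot /= /N.
  by field.
- move=> w x y z.
  rewrite /ppsi /minor4 /minor3 /minor2 !coordsQ//.
  move: (coords _) (coords _) (coords _) (coords _) => W X Y Z.
  rewrite /psihat /minor4 /minor3 /minor2 /rot12 /rot4 /= /N.
  by field.
Qed.

Ltac ppsi_delta := by rewrite /ppsi /minor4 /minor3 /minor2 /pdelta /=; ring.

Lemma psi_inj F (t t' : E) : F \in unitmx ->
  let psi := psi_of (F *m F^T) (pullback F vol0) (pullback F phi0) in
  (forall x y z, contract t psi (vec3 x y z) = contract t' psi (vec3 x y z)) ->
  t = t'.
Proof.
move=> uF psi tt'; rewrite -[t](mulmxK uF) -[t'](mulmxK uF); congr (_ *m _).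
have h (i j k : nat) : (i < 7)%N -> (j < 7)%N -> (k < 7)%N ->
    ppsi (coords (t *m F)) (pdelta i) (pdelta j) (pdelta k) =
    ppsi (coords (t' *m F)) (pdelta i) (pdelta j) (pdelta k).
  move=> i7 j7 k7; pose e n : E := ebase (inord n) *m invmx F.
  have := tt' (e i) (e j) (e k); rewrite !psi_coords// /e !mulmxKV//.
  by rewrite !coords_ebase !inordK.
(* For each coordinate, a basis triple that completes it to a monomial of psi0, ordered so that the
   sign is positive. *)
have e0 x : ppsi x (pdelta 2) (pdelta 4) (pdelta 6) = x 0%N :> R by ppsi_delta.
have e1 x : ppsi x (pdelta 2) (pdelta 5) (pdelta 6) = x 1%N :> R by ppsi_delta.
have e2 x : ppsi x (pdelta 5) (pdelta 1) (pdelta 6) = x 2%N :> R by ppsi_delta.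
have e3 x : ppsi x (pdelta 4) (pdelta 5) (pdelta 6) = x 3%N :> R by ppsi_delta.
have e4 x : ppsi x (pdelta 5) (pdelta 3) (pdelta 6) = x 4%N :> R by ppsi_delta.
have e5 x : ppsi x (pdelta 3) (pdelta 4) (pdelta 6) = x 5%N :> R by ppsi_delta.
have e6 x : ppsi x (pdelta 4) (pdelta 3) (pdelta 5) = x 6%N :> R by ppsi_delta.
apply: coordsP => -[|[|[|[|[|[|[|n]]]]]]]//= _.
- by rewrite -!e0 h.
- by rewrite -!e1 h.
- by rewrite -!e2 h.
- by rewrite -!e3 h.
- by rewrite -!e4 h.
- by rewrite -!e5 h.
- by rewrite -!e6 h.
Qed.

(* The derivative of sigma_V(phi) when V has derivative (a', al') and phi has
   derivative 2 tau _| psi; that of psi follows from ppsi_cross. *)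
Definition sigma_variation (G : 'M[R]_7) (vol : mform R 7) (phi : mform R 3)
    (a : R) (al : E) (a' : R) (al' tau x y z : E) : R :=
  let i := ip G in let f u v w := phi (vec3 u v w) in
  let p t u v w := contract t (psi_of G vol phi) (vec3 u v w) in
  let cr := cross G phi in
  let N := a * a + i al al in
  let B := (a * a - i al al) * f x y z - 2 * a * p al x y z
    + 2 * (i al x * f al y z - i al y * f al x z + i al z * f al x y) in
  - (2 * a * a' + 2 * i al' al) / (N * N) * B + N^-1 *
  ((2 * a * a' - 2 * i al' al) * f x y z + (a * a - i al al) * (2 * p tau x y z)
   - 2 * a' * p al x y z
   - 2 * a * (p al' x y z + 2 * (p tau al x (cr y z) + p tau y z (cr al x)))
   + 2 * (i al' x * f al y z - i al' y * f al x z + i al' z * f al x y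
     + i al x * (f al' y z + 2 * p tau al y z)
     - i al y * (f al' x z + 2 * p tau al x z)
     + i al z * (f al' x y + 2 * p tau al x y))).

Lemma psihat_lin a b c (u v x y z : nat -> R) :
  psihat a b (pscal c (padd u v)) x y z =
  c * (psihat a b u x y z + psihat a b v x y z).
Proof. rewrite /psihat /minor4 /minor3 /minor2 /pscal /padd; ring. Qed.

(** The second factor of the last product is N^-1 conj V' + c conj V, the shape of the derivative of
    V^-1 = N^-1 conj V. Since V conj V is real, the statement holds for every c. *)
Lemma sigma_variation_frame F a al a' al' tau c b x y z : F \in unitmx ->
  coords (al *m F) = pe1 b -> a * a + b * b != 0 ->
  let G := F *m F^T in let vol := pullback F vol0 in let phi := pullback F phi0 in
  let N := a * a + ip G al al in
  let t := (oct_Ad G phi (a, al) (0, tau)).2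
    + (oct_mul G phi (a, al) (N^-1 * a' + c * a, - (N^-1 *: al' + c *: al))).2 in
  sigma_variation G vol phi a al a' al' tau x y z =
  2 * contract t (psi_of G vol (sigma_at G vol phi (a, al))) (vec3 x y z).
Proof.
move=> uF alE N0 G vol phi N t.
have NE : N = a * a + b * b.
  by rewrite /N ip_coords alE /pdot /pe1; ring.
have tE : coords (t *m F) = pscal N^-1
    (padd (pAd a b (coords (tau *m F))) (pVdV a b a' (coords (al' *m F)))).
  rewrite /t /oct_Ad /oct_inv /oct_norm2 /oct_ip /= -/N.
  rewrite !(mulmxDl, =^~scalemxAl, mulNmx, coordsA, coordsZ, coordsN, cross_coords)//.
  rewrite !ip_coords alE; move: (coords _) (coords _) => T A'.
  rewrite NE in N0 *.
  apply/funext => n; rewrite /pAd /pVdV /padd /pscal /pcross /minor2 /pdot /pe1.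
  by case: n => [|[|[|[|[|[|[|n]]]]]]]/=; field.
have [Q [oQ dQ sE pE]] := sigma_frame uF alE N0.
have uFQ : F *m Q \in unitmx.
  rewrite unitmx_mul uF unitmxE; apply/unitrP; exists 1; rewrite dQ.
  by rewrite mulr1.
set X := coords (x *m F); set Y := coords (y *m F); set Z := coords (z *m F).
set T := coords (tau *m F) in tE *; set A' := coords (al' *m F) in tE *.
(* One factor N^-1 comes from [psihat], the other from the inverse of V inside t. *)
have -> : contract t (psi_of G vol (sigma_at G vol phi (a, al))) (vec3 x y z) =
    N^-1 * (N^-1 * (psihat a b (pAd a b T) X Y Z + psihat a b (pVdV a b a' A') X Y Z)).
  rewrite sE (_ : G = (F *m Q) *m (F *m Q)^T); last first.
    by rewrite trmx_mul mulmxA -(mulmxA F Q) oQ mulmx1.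
  rewrite /vol -(pullback_vol0 F dQ) psi_coords//.
  by apply: (mulfI N0); rewrite pE tE psihat_lin NE mulVKf.
set P1 := psihat a b (pAd _ _ _) _ _ _; set P2 := psihat a b (pVdV _ _ _ _) _ _ _.
have -> : 2 * (N^-1 * (N^-1 * (P1 + P2))) = N^-1 * N^-1 * (2 * P1 + 2 * P2) by ring.
rewrite -torsion_variation -section_variation.
rewrite /sigma_variation /G /vol /phi !ip_coords !pullback_vec3 !psi_coords//.
rewrite !cross_coords// alE -/X -/Y -/Z -/T -/A' NE.
have -> : pdot (pe1 b) (pe1 b) = b * b by rewrite /pdot /pe1; ring.
by field.
Qed.

End SigmaFrame.

(** * Directional and covariant derivatives *)

Section Derivatives.
Local Open Scope classical_set_scope.
Context {R : realType}.
Local Notation E := ('rV[R]_7).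
Variables (x X : E).
Implicit Types f h : E -> R.

Lemma is_derive_add f h df dh : is_derive x X f df -> is_derive x X h dh ->
  is_derive x X (fun y => f y + h y) (df + dh).
Proof. by move=> ? ?; exact: is_deriveD. Qed.

Lemma is_derive_opp f df : is_derive x X f df ->
  is_derive x X (fun y => - f y) (- df).
Proof. by move=> ?; exact: is_deriveN. Qed.

Lemma is_derive_mul f h df dh : is_derive x X f df -> is_derive x X h dh ->
  is_derive x X (fun y => f y * h y) (df * h x + f x * dh).
Proof.
move=> Hf Hh; have H := @is_deriveM _ _ f h x X df dh Hf Hh; apply: (is_derive_eq H).
by rewrite addrC [df * _]mulrC.
Qed.

Lemma is_derive_const (c : R) : is_derive x X (fun=> c) 0.
Proof. exact: is_derive_cst. Qed.

Lemma is_derive_inv f df : f x != 0 -> is_derive x X f df ->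
  is_derive x X (fun y => (f y)^-1) (- df / (f x * f x)).
Proof.
move=> f0 [fd <-]; apply: DeriveDef; first exact: derivableV.
by rewrite deriveV// /GRing.scale /=; field.
Qed.

Lemma is_derive_bigsum I (r : seq I) (F : I -> E -> R) (dF : I -> R) :
  (forall i, is_derive x X (F i) (dF i)) ->
  is_derive x X (fun y => \sum_(i <- r) F i y) (\sum_(i <- r) dF i).
Proof.
move=> HF; elim: r => [|i r IH].
  rewrite big_nil (_ : (fun y => _) = (fun=> 0)); first exact: is_derive_const.
  by apply/funext => y; rewrite big_nil.
rewrite big_cons (_ : (fun y => _) = (fun y => F i y + \sum_(i <- r) F i y)).
  exact: is_derive_add.
by apply/funext => y; rewrite big_cons.
Qed.

Lemma derivable_bigprod I (r : seq I) (F : I -> E -> R) :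
  (forall i, derivable (F i) x X) -> derivable (fun y => \prod_(i <- r) F i y) x X.
Proof.
move=> HF; elim: r => [|i r IH].
  rewrite (_ : (fun y => _) = (fun=> 1)); first exact: derivable_cst.
  by apply/funext => y; rewrite big_nil.
rewrite (_ : (fun y => _) = (fun y => F i y * \prod_(i <- r) F i y)).
  by have [] := is_derive_mul (derivableP (HF i)) (derivableP IH).
by apply/funext => y; rewrite big_cons.
Qed.

Lemma derivable_det n (A : E -> 'M[R]_n) :
  (forall i j, derivable (fun y => A y i j) x X) ->
  derivable (fun y => \det (A y)) x X.
Proof.
move=> HA; rewrite /determinant.
have H : is_derive x X (fun y => \sum_(s : 'S_n) (-1) ^+ s * \prod_i A y i (s i))
  (\sum_(s : 'S_n) 'D_X (fun y => (-1) ^+ s * \prod_i A y i (s i)) x).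
  apply: is_derive_bigsum => s; apply/derivableP/derivableM.
    exact: derivable_cst.
  exact: derivable_bigprod.
by case: H.
Qed.

Lemma derivable_invmx n (A : E -> 'M[R]_n) i j :
  (\forall y \near x, A y \in unitmx) ->
  (forall i j, derivable (fun y => A y i j) x X) ->
  derivable (fun y => invmx (A y) i j) x X.
Proof.
move=> uA HA.
apply: (@near_eq_derivable _ _ _ (fun y => (\det (A y))^-1 * cofactor (A y) j i)).
  near=> y; rewrite /invmx (_ : A y \in unitmx); last by near: y.
  by rewrite mxE mxE.
have uAx : A x \in unitmx := nbhs_singleton uA.
apply: derivableM.
  apply: derivableV; last exact: derivable_det.
  by rewrite -unitfE -unitmxE.
rewrite /cofactor; apply: derivableM; first exact: derivable_cst.
apply: derivable_det => k l.
rewrite (_ : (fun y => _) = (fun y => A y (lift j k) (lift i l))); first exact: HA.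
by apply/funext => y; rewrite !mxE.
Unshelve. all: by end_near. Qed.

Lemma is_derive_unique f df df' :
  is_derive x X f df -> is_derive x X f df' -> df = df'.
Proof. by move=> [_ <-] [_ <-]. Qed.

(** A product rule for evaluating a varying linear form on a varying vector; expanding the vector in
    the basis reduces it to products of scalars. *)
Lemma is_derive_linear (L : E -> E -> R) (L' : E -> R) (u : E -> E) (du : E) :
  (\forall y \near x, forall a v w, L y (a *: v + w) = a * L y v + L y w) ->
  (forall v, is_derive x X (fun y => L y v) (L' v)) ->
  (forall k, is_derive x X (fun y => u y 0 k) (du 0 k)) ->
  is_derive x X (fun y => L y (u y)) (L' (u x) + L x du).
Proof.
move=> lL HL Hu.
have lLx := nbhs_singleton lL.
have L'E v : L' v = \sum_k v 0 k * L' (ebase k).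
  have D k : is_derive x X (fun y => v 0 k * L y (ebase k)) (v 0 k * L' (ebase k)).
    exact: is_deriveZ.
  apply: (is_derive_unique (HL v)).
  apply: near_eq_is_derive (is_derive_bigsum _ D).
  by near=> y; rewrite (@scalar_row_sum _ (L y))//; near: y.
apply: (@near_eq_is_derive _ _ _ (fun y => \sum_k u y 0 k * L y (ebase k))).
  by near=> y; rewrite (@scalar_row_sum _ (L y) (u y))//; near: y.
rewrite L'E (scalar_row_sum du lLx) -big_split /=.
have D k := is_derive_mul (Hu k) (HL (ebase k)).
apply: is_derive_eq (is_derive_bigsum _ D) _.
by apply: eq_bigr => k _; rewrite addrC.
Unshelve. all: by end_near. Qed.

End Derivatives.

Section CovariantDerivatives.
Local Open Scope classical_set_scope.
Context {R : realType}.
Local Notation E := ('rV[R]_7).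
Variables (g : E -> 'M[R]_7) (x X : E).
Hypothesis dg : forall k l, differentiable (fun y => g y k l) x.
Hypothesis sg : \forall y \near x, (g y)^T = g y.
Hypothesis ug : \forall y \near x, g y \in unitmx.
Local Notation Gam := (christoffel g x X).

Let ugx : g x \in unitmx := nbhs_singleton ug.
Let sgx : (g x)^T = g x := nbhs_singleton sg.

(* u' is the covariant derivative along X at x of the vector field u. *)
Definition cov_derive (u : E -> E) (u' : E) : Prop :=
  forall k, is_derive x X (fun y => u y 0 k) ((u' - Gam (u x)) 0 k).

Lemma cov_derive_cst v : cov_derive (fun=> v) (Gam v).
Proof. by move=> k; rewrite subrr mxE; exact: is_derive_const. Qed.

Lemma cov_derive_nabla (u : E -> E) : (forall k, derivable (fun y => u y 0 k) x X) ->
  cov_derive u (nabla_vec g u x X).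
Proof.
by move=> du k; rewrite /nabla_vec addrK mxE; apply/derivableP.
Qed.

Lemma nabla_vecE (u : E -> E) u' : cov_derive u u' -> nabla_vec g u x X = u'.
Proof.
move=> Hu; rewrite /nabla_vec -[RHS](subrK (Gam (u x))); congr (_ + _).
by apply/rowP => k; rewrite mxE; case: (Hu k).
Qed.

Lemma ipBl (G : 'M[R]_7) (u v w : E) : ip G (u - v) w = ip G u w - ip G v w.
Proof. by rewrite addrC -scaleN1r ip_linearl mulN1r addrC. Qed.

Lemma ipBr (G : 'M[R]_7) (u v w : E) : ip G w (u - v) = ip G w u - ip G w v.
Proof. by rewrite addrC -scaleN1r ip_linearr mulN1r addrC. Qed.

(** This is nabla g = 0, the compatibility half of [christoffelP]. *)
Lemma is_derive_metric u v : is_derive x X (fun y => ip (g y) u v)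
  (ip (g x) (Gam u) v + ip (g x) u (Gam v)).
Proof.
have [_ h] := christoffelP (christoffel g x) sg ugx dg.
have [_ <-] := h (fun _ _ => erefl).
by apply/derivableP/diff_derivable/differentiable_ip.
Qed.

Lemma is_derive_ip u v u' v' : cov_derive u u' -> cov_derive v v' ->
  is_derive x X (fun y => ip (g y) (u y) (v y))
    (ip (g x) u' (v x) + ip (g x) (u x) v').
Proof.
move=> Hu Hv.
have H1 w : is_derive x X (fun y => ip (g y) (u y) w)
    (ip (g x) u' w + ip (g x) (u x) (Gam w)).
  apply: is_derive_eq.
    apply: (@is_derive_linear _ x X (fun y v => ip (g y) v w) _ u _ _ _ Hu).
      by near=> y => a v1 v2; rewrite ip_linearl.
    by move=> v1; exact: is_derive_metric.
  by rewrite /= ipBl; ring.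
apply: is_derive_eq.
  apply: (@is_derive_linear _ x X (fun y w => ip (g y) (u y) w) _ v _ _ H1 Hv).
  by near=> y => a v1 v2; rewrite ip_linearr.
by rewrite /= ipBr; ring.
Unshelve. all: by end_near. Qed.

Variable phi : E -> mform R 3.
Hypothesis dphi : forall v, differentiable (fun y => phi y v) x.
Hypothesis mphi : \forall y \near x, multilinear (phi y).
Let mphix : multilinear (phi x) := nbhs_singleton mphi.
Local Notation nphi := (nabla_form g phi x X).

Lemma vec3_with0 (u v w z : E) :
  [eta vec3 u v w with ord0 |-> z] = vec3 z v w :> ('I_3 -> E).
Proof. by apply/funext => -[[|[|[|m]]] im]. Qed.

Lemma vec3_with1 (u v w z : E) :
  [eta vec3 u v w with lift ord0 ord0 |-> z] = vec3 u z w :> ('I_3 -> E).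
Proof. by apply/funext => -[[|[|[|m]]] im]. Qed.

Lemma vec3_with2 (u v w z : E) :
  [eta vec3 u v w with lift ord0 (lift ord0 ord0) |-> z] = vec3 u v z :> ('I_3 -> E).
Proof. by apply/funext => -[[|[|[|m]]] im]. Qed.

Lemma sum_vec3_with (w : mform R 3) (h : E -> E) (u v z : E) :
  \sum_(m < 3) w [eta vec3 u v z with m |-> h (vec3 u v z m)] =
  w (vec3 (h u) v z) + w (vec3 u (h v) z) + w (vec3 u v (h z)).
Proof.
rewrite !big_ord_recl big_ord0 addr0 addrA.
congr (w _ + w _ + w _).
- exact: vec3_with0.
- exact: vec3_with1.
- exact: vec3_with2.
Qed.

Lemma nabla_form_vec3 (w : E -> mform R 3) u v z :
  nabla_form g w x X (vec3 u v z) = 'D_X (fun y => w y (vec3 u v z)) x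
    - (w x (vec3 (Gam u) v z) + w x (vec3 u (Gam v) z) + w x (vec3 u v (Gam z))).
Proof.
by rewrite /nabla_form sum_vec3_with.
Qed.

Lemma form3D0 (w : mform R 3) a (u u' v z : E) : multilinear w ->
  w (vec3 (a *: u + u') v z) = a * w (vec3 u v z) + w (vec3 u' v z).
Proof.
by move=> mw; rewrite -(vec3_with0 0 v z) mw !vec3_with0.
Qed.

(** Only the first slot varies: in [sigma_expand] the vector part of V is the only nonconstant
    field, and it enters phi and the cross product through the first argument. *)
Lemma is_derive_phi u u' v w : cov_derive u u' ->
  is_derive x X (fun y => phi y (vec3 (u y) v w))
    (nphi (vec3 (u x) v w) + phi x (vec3 u' v w) + phi x (vec3 (u x) (Gam v) w)
     + phi x (vec3 (u x) v (Gam w))).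
Proof.
move=> Hu.
have H1 z : is_derive x X (fun y => phi y (vec3 z v w))
    (nphi (vec3 z v w) + phi x (vec3 (Gam z) v w) + phi x (vec3 z (Gam v) w)
     + phi x (vec3 z v (Gam w))).
  apply: is_derive_eq; first by apply/derivableP/diff_derivable.
  by rewrite nabla_form_vec3; ring.
apply: is_derive_eq.
  apply: (@is_derive_linear _ x X (fun y z => phi y (vec3 z v w)) _ u _ _ H1 Hu).
  by near=> y => a z z'; apply: form3D0; near: y.
rewrite /= -[in RHS](subrK (Gam (u x)) u') -[u' - _]scale1r form3D0// mul1r.
by rewrite scale1r; ring.
Unshelve. all: by end_near. Qed.

(** Derivability comes from the coordinate formula through [invmx]; the value then follows by
    differentiating <u * v, w> = phi(u, v, w) in two ways, where the Christoffel terms of w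
    cancel. *)
Lemma cov_derive_cross u u' v : cov_derive u u' ->
  exists2 c', cov_derive (fun y => cross (g y) (phi y) (u y) v) c' &
    forall w, ip (g x) c' w =
      nphi (vec3 (u x) v w) + phi x (vec3 u' v w) + phi x (vec3 (u x) (Gam v) w).
Proof.
move=> Hu; pose c y := cross (g y) (phi y) (u y) v.
have dc k : derivable (fun y => c y 0 k) x X.
  rewrite (_ : (fun y => c y 0 k) = (fun y =>
      \sum_l phi y (vec3 (u y) v (ebase l)) * invmx (g y) l k)); last first.
    by apply/funext => y; rewrite mxE; apply: eq_bigr => l _; rewrite mxE.
  suff [] : is_derive x X (fun y =>
      \sum_l phi y (vec3 (u y) v (ebase l)) * invmx (g y) l k)
    (\sum_l 'D_X (fun y => phi y (vec3 (u y) v (ebase l)) * invmx (g y) l k) x).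
    by [].
  apply: is_derive_bigsum => l; apply/derivableP/derivableM.
    by have [] := is_derive_phi v (ebase l) Hu.
  apply: derivable_invmx => // i j; exact: diff_derivable.
have Hc := cov_derive_nabla dc.
exists (nabla_vec g c x X) => // w.
have H1 := is_derive_ip Hc (cov_derive_cst w).
have H2 : is_derive x X (fun y => ip (g y) (c y) w)
    (nphi (vec3 (u x) v w) + phi x (vec3 u' v w) + phi x (vec3 (u x) (Gam v) w)
     + phi x (vec3 (u x) v (Gam w))).
  apply: near_eq_is_derive (is_derive_phi v w Hu).
  by near=> y; rewrite crossP//; near: y.
have := is_derive_unique H1 H2; rewrite [ip _ (c x) _]crossP// => /eqP.
by rewrite -subr_eq addrK => /eqP.
Unshelve. all: by end_near. Qed.

End CovariantDerivatives.

(** * The covariant derivative of sigma_V(phi) *)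

Section SigmaDerivative.
Local Open Scope classical_set_scope.
Context {R : realType}.
Local Notation E := ('rV[R]_7).

Definition is_frame (F G : 'M[R]_7) (vol : mform R 7) (phi : mform R 3) : Prop :=
  [/\ F \in unitmx, G = F *m F^T, vol = pullback F vol0 & phi = pullback F phi0].

(* sigma_V(phi) with psi eliminated by psi_crossE: only g, phi and the cross
   product remain to be differentiated. *)
Definition sigma_expand (G : 'M[R]_7) (phi : mform R 3) (a : R) (al u v w : E) : R :=
  let i := ip G in let f p q r := phi (vec3 p q r) in
  (a * a + i al al)^-1 *
  ((a * a - i al al) * f u v w
   - 2 * a * (i (cross G phi al u) (cross G phi v w) - i al v * i u w + i al w * i u v)
   + 2 * (i al u * f al v w - i al v * f al u w + i al w * f al u v)).

Lemma psi_crossE F G vol phi (t u v w : E) : is_frame F G vol phi ->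
  contract t (psi_of G vol phi) (vec3 u v w) =
  ip G (cross G phi t u) (cross G phi v w) - ip G t v * ip G u w + ip G t w * ip G u v.
Proof.
by case=> uF -> -> ->; rewrite psi_coords// ppsi_cross !ip_coords !cross_coords.
Qed.

Lemma sigma_expandE F G vol phi a (al u v w : E) : is_frame F G vol phi ->
  sigma_at G vol phi (a, al) (vec3 u v w) = sigma_expand G phi a al u v w.
Proof.
move=> fr; rewrite /sigma_at /sigma_expand (psi_crossE _ _ _ _ fr).
case: fr => uF -> _ ->; rewrite wedge_flat_contract /oct_norm2 /oct_ip /=.
by rewrite expr2.
Qed.

Variables (g : E -> 'M[R]_7) (vol : E -> mform R 7) (phi : E -> mform R 3).
Variables (a : E -> R) (al : E -> E) (x X : E) (a' : R) (al' tau : E).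
Hypothesis dg : forall k l, differentiable (fun y => g y k l) x.
Hypothesis dphi : forall v, differentiable (fun y => phi y v) x.
Hypothesis fr : \forall y \near x, exists F, is_frame F (g y) (vol y) (phi y).
Hypothesis da : is_derive x X a a'.
Hypothesis dal : cov_derive g x X al al'.
Hypothesis Tphi : forall v, nabla_form g phi x X v =
  2 * contract tau (psi_of (g x) (vol x) (phi x)) v.
Hypothesis N0 : a x * a x + ip (g x) (al x) (al x) != 0.

Lemma near_frame_sym : \forall y \near x, (g y)^T = g y.
Proof. by near=> y; have [F [_ -> _ _]] : exists F, is_frame F (g y) (vol y) (phi y);
  [near: y|rewrite trmx_mul trmxK]. Unshelve. all: by end_near. Qed.

Lemma near_frame_unit : \forall y \near x, g y \in unitmx.
Proof. by near=> y; have [F [uF -> _ _]] : exists F, is_frame F (g y) (vol y) (phi y);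
  [near: y|exact: frame_unit]. Unshelve. all: by end_near. Qed.

Lemma near_frame_multilinear : \forall y \near x, multilinear (phi y).
Proof. by near=> y; have [F [_ _ _ ->]] : exists F, is_frame F (g y) (vol y) (phi y);
  [near: y|exact/multilinear_pullback/multilinear_phi0]. Unshelve. all: by end_near. Qed.

(** The product rule on [sigma_expand], term by term. The Christoffel terms produced by the constant
    arguments u, v, w are those subtracted in [nabla_form], so they all cancel. *)
Lemma nabla_sigma u v w :
  nabla_form g (fun y => sigma_at (g y) (vol y) (phi y) (a y, al y)) x X (vec3 u v w) =
  sigma_variation (g x) (vol x) (phi x) (a x) (al x) a' al' tau u v w.
Proof.
have sg := near_frame_sym; have ug := near_frame_unit.
have mphi := near_frame_multilinear.
have [F frx] := nbhs_singleton fr.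
have sgx := nbhs_singleton sg; have ugx := nbhs_singleton ug.
have mx := nbhs_singleton mphi.
have cst p := cov_derive_cst g x X p.
have IP p q p' q' := @is_derive_ip _ g x X dg sg ug p q p' q'.
have MET p q := is_derive_metric X dg sg ug p q.
have PHI p p' q r := @is_derive_phi _ g x X phi dphi mphi p p' q r.
have [c1 Hc1 E1] := @cov_derive_cross _ g x X dg sg ug phi dphi mphi _ _ u dal.
have [c2 Hc2 E2] := @cov_derive_cross _ g x X dg sg ug phi dphi mphi _ _ w (cst v).
have Haa := is_derive_mul da da.
have Hnn := IP _ _ _ _ dal dal.
have H1 := is_derive_mul (is_derive_add Haa (is_derive_opp Hnn)) (PHI _ _ v w (cst u)).
have Hcc := IP _ _ _ _ Hc1 Hc2.
have Hu := IP _ _ _ _ dal (cst u).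
have Hv := IP _ _ _ _ dal (cst v).
have Hw := IP _ _ _ _ dal (cst w).
have H2 := is_derive_mul (is_derive_mul (is_derive_const x X (2 : R)) da)
  (is_derive_add (is_derive_add Hcc (is_derive_opp (is_derive_mul Hv (MET u w))))
    (is_derive_mul Hw (MET u v))).
have H3 := is_derive_mul (is_derive_const x X (2 : R))
  (is_derive_add (is_derive_add (is_derive_mul Hu (PHI _ _ v w dal))
     (is_derive_opp (is_derive_mul Hv (PHI _ _ u w dal))))
    (is_derive_mul Hw (PHI _ _ u v dal))).
have Hall := is_derive_mul (is_derive_inv N0 (is_derive_add Haa Hnn))
  (is_derive_add (is_derive_add H1 (is_derive_opp H2)) H3).
rewrite nabla_form_vec3.
have Hs : \forall y \near x, sigma_expand (g y) (phi y) (a y) (al y) u v w =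
    sigma_at (g y) (vol y) (phi y) (a y, al y) (vec3 u v w).
  near=> y; have [F' fr'] : exists F, is_frame F (g y) (vol y) (phi y) by near: y.
  by rewrite (sigma_expandE _ _ _ _ _ fr').
have [_ ->] := near_eq_is_derive Hs Hall.
rewrite !(sigma_expandE _ _ _ _ _ frx) {Hs Hall H1 H2 H3 Hcc Hu Hv Hw Hnn Haa}.
rewrite [ip _ (cross _ _ (al x) u) c2]ipC// E1 E2 !Tphi.
move: (christoffel g x X u) (christoffel g x X v) (christoffel g x X w) => Gu Gv Gw.
(* Differentiated cross products appear as phi(p, q, r * s) and undifferentiated ones as <p * q, r *
   s>; a common form lets [field] match them. *)
have CP p q r : phi x (vec3 p q (cross (g x) (phi x) r.1 r.2)) =
    ip (g x) (cross (g x) (phi x) p q) (cross (g x) (phi x) r.1 r.2).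
  by rewrite crossP.
rewrite (CP al' u (v, w)) (CP (al x) Gu (v, w)).
rewrite (CP Gv w (al x, u)) (CP v Gw (al x, u)) /=.
rewrite (ipC (cross _ _ Gv w) (cross _ _ (al x) u) sgx).
rewrite (ipC (cross _ _ v Gw) (cross _ _ (al x) u) sgx).
rewrite [ip (g x) (al x) al']ipC// /sigma_variation /sigma_expand.
rewrite (psi_crossE (al x) _ _ _ frx) (psi_crossE al' _ _ _ frx).
pose f p q r := phi x (vec3 p q r); pose i := ip (g x).
pose p t q r s := contract t (psi_of (g x) (vol x) (phi x)) (vec3 q r s).
pose cr := cross (g x) (phi x).
rewrite -!/(f _ _ _) -!/(p _ _ _ _) -!/(cr _ _) -!/(i _ _).
have i0 : a x * a x + i (al x) (al x) != 0 by [].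
clearbody f i p cr.
by field.
Unshelve. all: by end_near. Qed.

End SigmaDerivative.

(** * The torsion of sigma_V(phi) *)

Section PointwiseTorsion.
Context {R : realType}.
Local Notation E := ('rV[R]_7).
Implicit Types (F G : 'M[R]_7) (vol : mform R 7) (phi : mform R 3).

Lemma associated_is_frame G vol phi (al : E) : positive_form phi ->
  associated_metric_at phi G vol ->
  exists2 F, is_frame F G vol phi &
    forall n, (0 < n < 7)%N -> coords (al *m F) n = 0.
Proof.
move=> /(positive_frame al)[F [uF -> z]] /(frame_associated_unique uF)[-> ->].
by exists F.
Qed.

Lemma is_frame_associated F G vol phi :
  is_frame F G vol phi -> associated_metric_at phi G vol.
Proof. by case=> uF -> -> ->; exact: frame_associated. Qed.

Lemma is_frame_unique F G vol phi G' vol' : is_frame F G vol phi ->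
  associated_metric_at phi G' vol' -> G' = G /\ vol' = vol.
Proof. by case=> uF -> -> -> /(frame_associated_unique uF). Qed.

Lemma is_frame_psi_inj F G vol phi (t t' : E) : is_frame F G vol phi ->
  (forall x y z, contract t (psi_of G vol phi) (vec3 x y z) =
                 contract t' (psi_of G vol phi) (vec3 x y z)) -> t = t'.
Proof. by case=> uF -> -> ->; exact: psi_inj. Qed.

Lemma coords_pe1 (u : E) : (forall n, (0 < n < 7)%N -> coords u n = 0) ->
  coords u = pe1 (coords u 0).
Proof.
move=> z; apply/funext => -[|n]//=; case: (ltnP n.+1 7) => [n7|n7].
  exact: z.
by rewrite /coords ltnNge n7.
Qed.

Lemma pe1_norm_neq0 F a (al : E) b : F \in unitmx -> (a, al) <> (0, 0) ->
  coords (al *m F) = pe1 b -> a * a + b * b != 0.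
Proof.
move=> uF V0 alE; apply/negP; rewrite -!expr2 paddr_eq0 ?sqr_ge0// !sqrf_eq0.
move=> /andP[/eqP a0 /eqP b0]; apply: V0; rewrite a0; congr (_, _).
rewrite -(mulmxK uF al) (_ : al *m F = 0) ?mul0mx//; apply: coordsP => n _.
by rewrite alE b0 /coords mxE; case: ifP; case: n.
Qed.

Lemma sigma_is_frame G vol phi (V : oct R) : positive_form phi ->
  associated_metric_at phi G vol -> V <> (0, 0) ->
  exists F, is_frame F G vol (sigma_at G vol phi V).
Proof.
case: V => a al pphi aphi V0.
have [F [uF -> -> ->] /coords_pe1 alE] := associated_is_frame al pphi aphi.
have [Q [oQ dQ -> _]] := sigma_frame uF alE (pe1_norm_neq0 uF V0 alE).
exists (F *m Q); split => //.
- by rewrite unitmx_mul uF unitmxE dQ unitr1.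
- by rewrite trmx_mul mulmxA -(mulmxA F Q) oQ mulmx1.
- by rewrite pullback_vol0.
Qed.

Lemma sigma_variationE G vol phi a (al : E) a' al' tau c x y z :
  positive_form phi -> associated_metric_at phi G vol -> (a, al) <> (0, 0) ->
  let N := a * a + ip G al al in
  let t := (oct_Ad G phi (a, al) (0, tau)).2
    + (oct_mul G phi (a, al) (N^-1 * a' + c * a, - (N^-1 *: al' + c *: al))).2 in
  sigma_variation G vol phi a al a' al' tau x y z =
  2 * contract t (psi_of G vol (sigma_at G vol phi (a, al))) (vec3 x y z).
Proof.
move=> pphi aphi V0.
have [F [uF -> -> ->] /coords_pe1 alE] := associated_is_frame al pphi aphi.
exact: (sigma_variation_frame a' al' tau c x y z uF alE (pe1_norm_neq0 uF V0 alE)).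
Qed.

Lemma oct_norm2_neq0 F G vol phi (V : oct R) : is_frame F G vol phi ->
  V <> (0, 0) -> oct_norm2 G V != 0.
Proof.
case: V => a al [uF -> _ _] V0; rewrite /oct_norm2 /oct_ip /= ip_frame.
apply/negP => /eqP N0; have [u0|u0] := eqVneq (al *m F) 0.
  apply: V0; move: N0; rewrite u0 ip1E big1 => [|k _]; last by rewrite mxE mul0r.
  rewrite addr0 -expr2 => /eqP; rewrite sqrf_eq0 => /eqP ->; congr (_, _).
  by rewrite -(mulmxK uF al) u0 mul0mx.
by have := ltr_wpDl (sqr_ge0 a) (ip1_gt0 u0); rewrite expr2 N0 ltxx.
Qed.

Lemma oct_norm2_ge0 F G vol phi (V : oct R) : is_frame F G vol phi ->
  0 <= oct_norm2 G V.
Proof.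
case: V => a al [uF -> _ _]; rewrite /oct_norm2 /oct_ip /= ip_frame ip1E.
by rewrite addr_ge0 -?expr2 ?sqr_ge0// sumr_ge0// => k _; rewrite -expr2 sqr_ge0.
Qed.

(** Conjugation gives Im(V conj V') = - Im(V' conj V), so the imaginary parts agree. On the right, V
    T V^-1 has real part 0 and that of V' V^-1 is the hypothesis divided by N. *)
Lemma torsion_constant_norm F G vol phi a (al : E) a' (al' tau : E) c :
  is_frame F G vol phi -> a * a' + ip G al' al = 0 ->
  let V := (a, al) in let N := oct_norm2 G V in
  oct_Im (oct_add (oct_Ad G phi V (0, tau))
    (oct_mul G phi V (N^-1 * a' + c * a, - (N^-1 *: al' + c *: al)))) =
  oct_opp (oct_mul G phi (oct_sub (a', al') (oct_mul G phi V (0, tau)))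
    (oct_inv G V)).
Proof.
case=> uF -> _ -> + V N; rewrite ip_coords => dN.
rewrite /oct_Im /oct_add /oct_opp /oct_Ad /oct_inv -/N /=; congr (_, _).
  rewrite !ip_coords !(mulmxDl, =^~scalemxAl, mulNmx, coordsA, coordsZ, coordsN, cross_coords)//.
  move: dN; move: (coords _) (coords _) (coords _) => T A A' dN.
  rewrite [LHS](_ : _ = - N^-1 * (a * a' + pdot A' A)); last by rewrite dN mulr0.
  rewrite /padd /pscal /pdot /pcross /minor2; ring.
apply: (can_inj (mulmxK uF)); apply: coordsP => n n7.
rewrite !ip_coords !(mulmxDl, =^~scalemxAl, mulNmx, coordsA, coordsZ, coordsN, cross_coords)//.
move: {dN} (coords _) (coords _) (coords _) => T A A'.
rewrite /padd /pscal /pdot /pcross /minor2.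
by case: n n7 => [|[|[|[|[|[|[|n]]]]]]]//= _; ring.
Qed.

End PointwiseTorsion.

(** * The covariant derivative of V^-1 *)

Section InverseDerivative.
Local Open Scope classical_set_scope.
Context {R : realType}.
Local Notation E := ('rV[R]_7).
Variables (g : E -> 'M[R]_7) (a : E -> R) (al : E -> E) (x X : E) (a' : R) (al' : E).
Hypothesis dg : forall k l, differentiable (fun y => g y k l) x.
Hypothesis sg : \forall y \near x, (g y)^T = g y.
Hypothesis ug : \forall y \near x, g y \in unitmx.
Hypothesis da : is_derive x X a a'.
Hypothesis dal : cov_derive g x X al al'.

(** Read off from metric compatibility by differentiating g(c v, w) = c g(v, w) on both sides. *)
Lemma christoffelZ (c : R) (v : E) :
  christoffel g x X (c *: v) = c *: christoffel g x X v.
Proof.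
apply: (ip_inj (nbhs_singleton ug)) => w.
have ipZ b u u' : ip (g x) (b *: u) u' = b * ip (g x) u u'.
  by rewrite /ip -!scalemxAl mxE.
have H1 := is_derive_metric X dg sg ug (c *: v) w.
have H2 := is_derive_mul (is_derive_const x X c) (is_derive_metric X dg sg ug v w).
have E12 : (fun y => ip (g y) (c *: v) w) = (fun y => c * ip (g y) v w).
  by apply/funext => y; rewrite /ip -!scalemxAl mxE.
rewrite E12 in H1; have := is_derive_unique H1 H2.
move: (christoffel _ _ _ (c *: v)) (christoffel _ _ _ v) (christoffel _ _ _ w).
by move=> Gc Gv Gw; rewrite !ipZ mul0r add0r mulrDr => /addIr ->.
Qed.

Lemma is_derive_oct_norm2 : is_derive x X (fun y => oct_norm2 (g y) (a y, al y))
  (2 * a x * a' + 2 * ip (g x) al' (al x)).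
Proof.
apply: is_derive_eq.
  exact: (is_derive_add (is_derive_mul da da) (is_derive_ip dg sg ug dal dal)).
by rewrite [ip _ (al x) al']ipC ?(nbhs_singleton sg)//; ring.
Qed.

Lemma nabla_oct_inv : oct_norm2 (g x) (a x, al x) != 0 ->
  let N := oct_norm2 (g x) (a x, al x) in
  let c := - (2 * a x * a' + 2 * ip (g x) al' (al x)) / (N * N) in
  nabla_oct g (fun y => oct_inv (g y) (a y, al y)) x X =
  (N^-1 * a' + c * a x, - (N^-1 *: al' + c *: al x)).
Proof.
move=> N0 N c.
have dN := is_derive_inv N0 is_derive_oct_norm2.
rewrite /nabla_oct; congr (_, _).
  by have [_ ->] := is_derive_mul dN da; rewrite addrC.
apply: nabla_vecE => k.
have dk := is_derive_mul dN (is_derive_opp (dal k)).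
rewrite (_ : (fun y => _) = (fun y => (oct_norm2 (g y) (a y, al y))^-1 * - al y 0 k)).
  apply: is_derive_eq dk _.
  rewrite (_ : (oct_inv _ _).2 = (- N^-1) *: al x); last by rewrite scaleNr -scalerN.
  by rewrite christoffelZ !mxE -/N -/c; ring.
by apply/funext => y; rewrite !mxE.
Qed.

End InverseDerivative.

(** * Torsion on the manifold *)

Section TorsionFields.
Local Open Scope classical_set_scope.
Context {R : realType} (M : manifold7 R).
Local Notation E := ('rV[R]_7).

Lemma near_eq_christoffel (g h : E -> 'M[R]_7) x X Y :
  (\forall y \near x, g y = h y) -> christoffel g x X Y = christoffel h x X Y.
Proof.
move=> gh.
have D Z u v : 'D_Z (fun y => ip (g y) u v) x = 'D_Z (fun y => ip (h y) u v) x.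
  by apply: near_eq_derive; apply: filterS gh => y ->.
rewrite /christoffel (nbhs_singleton gh).
apply: (congr1 (fun r => 2%:R^-1 *: (r *m invmx (h x)))).
by apply/rowP => k; rewrite [LHS]mxE [RHS]mxE (D X) (D Y) (D (ebase k)).
Qed.

Lemma near_chart (i : chart M) x : ccod i x -> \forall y \near x, ccod i y.
Proof. by move=> ix; apply: open_nbhs_nbhs; split => //; exact: ccod_open. Qed.

(** Removes the existential metric of [is_torsion]: by uniqueness any witness agrees with g and vol
    on each chart, hence has the same Christoffel symbols there. It serves both for phi and for
    sigma_V(phi). *)
Lemma is_torsionP (phi : chart_field M (mform R 3)) g vol (T : chart_field M 'M[R]_7) :
  smooth_tensor2 g -> smooth_form vol ->
  (forall i x, ccod i x -> exists F, is_frame F (g i x) (vol i x) (phi i x)) ->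
  is_torsion phi T <-> forall i x X v, ccod i x ->
    nabla_form (g i) (phi i) x X v =
    2 * contract (oct_of_tensor (g i x) (T i x) X).2
          (psi_of (g i x) (vol i x) (phi i x)) v.
Proof.
move=> sg sv fr; split=> [[g' [vol' [[_ _ ass'] HT]]] i x X v ix|HT]; last first.
  exists g, vol; split => //; split => // i x ix.
  by have [F /is_frame_associated] := fr i x ix.
have gE y : ccod i y -> g' i y = g i y /\ vol' i y = vol i y.
  by move=> iy; have [F /is_frame_unique] := fr i y iy; apply; exact: ass'.
have [gx vx] := gE x ix; have := HT i x X v ix; rewrite gx vx => <-.
rewrite /nabla_form; congr (_ - _); apply: eq_bigr => m _.
rewrite (_ : christoffel (g i) x X (v m) = christoffel (g' i) x X (v m))//.
apply: near_eq_christoffel; near=> y; have [|-> //] := gE y.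
by near: y; exact: near_chart.
Unshelve. all: by end_near. Qed.

Section Sigma.
Variables (phi : chart_field M (mform R 3)) (g : chart_field M 'M[R]_7).
Variables (vol : chart_field M (mform R 7)) (T : chart_field M 'M[R]_7).
Variable V : chart_field M (oct R).
Hypotheses (hphi : G2_structure phi) (hg : associated_metric phi g vol).
Hypotheses (hT : is_torsion phi T) (hV : oct_section V) (hV0 : nowhere_vanishing V).

Let sg : smooth_tensor2 g. Proof. by case: hg. Qed.
Let sv : smooth_form vol. Proof. by case: hg. Qed.

Let pos i x : ccod i x -> positive_form (phi i x).
Proof. by case: hphi => _; apply. Qed.

Let ass i x : ccod i x -> associated_metric_at (phi i x) (g i x) (vol i x).
Proof. by case: hg => _ _; apply. Qed.

Let fr i x : ccod i x -> exists F, is_frame F (g i x) (vol i x) (phi i x).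
Proof. by move=> ix; have [F] := associated_is_frame 0 (pos ix) (ass ix); exists F. Qed.

Lemma sigma_frame_field i x : ccod i x ->
  exists F, is_frame F (g i x) (vol i x) (sigma g vol V phi i x).
Proof. by move=> ix; exact: sigma_is_frame (pos ix) (ass ix) (hV0 ix). Qed.

Let dg i x k l : ccod i x -> differentiable (fun y => g i y k l) x.
Proof. by case: sg => h _; case: (h i k l 1%N) => + _; exact. Qed.

Let dphi i x v : ccod i x -> differentiable (fun y => phi i y v) x.
Proof. by case: hphi => -[_ h _] _; case: (h i v 1%N) => + _; exact. Qed.

Let da i x X : ccod i x ->
  is_derive x X (fun y => (V i y).1) ('D_X (fun y => (V i y).1) x).
Proof.
case: hV => h _ _ ix; apply/derivableP/diff_derivable.
by case: (h i 1%N) => + _; exact.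
Qed.

Let dal i x X : ccod i x -> cov_derive (g i) x X (fun y => (V i y).2)
  (nabla_vec (g i) (fun y => (V i y).2) x X).
Proof.
case: hV => _ h _ ix; apply: cov_derive_nabla => k; apply/diff_derivable.
by case: (h i k 1%N) => + _; exact.
Qed.

Let nfr i x : ccod i x ->
  \forall y \near x, exists F, is_frame F (g i y) (vol i y) (phi i y).
Proof. by move=> ix; near=> y; apply: fr; near: y; exact: near_chart.
Unshelve. all: by end_near. Qed.

(** The value of c, the derivative of |V|^-2, is hidden because the pointwise identities hold for
    every c. *)
Lemma nabla_inv_section i x X : ccod i x ->
  let N := oct_norm2 (g i x) (V i x) in
  exists c, nabla g (inv_section g V) i x X =
    (N^-1 * (nabla g V i x X).1 + c * (V i x).1,
     - (N^-1 *: (nabla g V i x X).2 + c *: (V i x).2)).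
Proof.
move=> ix N.
have [F frF] := fr ix.
have N0 := oct_norm2_neq0 frF (hV0 ix).
have := nabla_oct_inv (fun k l => dg k l ix) (near_frame_sym (nfr ix))
  (near_frame_unit (nfr ix)) (da X ix) (dal X ix).
move: N0; rewrite {1}[V i x]surjective_pairing => N0 /(_ N0).
rewrite -surjective_pairing -/N /=; set c := - _ / _ => H; exists c.
by rewrite -H /nabla /inv_section; congr (nabla_oct _ _ x X).
Qed.

Lemma nabla_sigma_field i x X v : ccod i x ->
  nabla_form (g i) (sigma g vol V phi i) x X v =
  2 * contract
    (oct_Im (oct_add (oct_Ad (g i x) (phi i x) (V i x) (torsion_form g T i x X))
      (oct_mul (g i x) (phi i x) (V i x) (nabla g (inv_section g V) i x X)))).2
    (psi_of (g i x) (vol i x) (sigma g vol V phi i x)) v.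
Proof.
move=> ix; have [F frF] := fr ix.
have N0 := oct_norm2_neq0 frF (hV0 ix).
have [c ->] := nabla_inv_section X ix.
have Tphi := fun v => (is_torsionP T sg sv fr).1 hT i x X v ix.
have V0 : ((V i x).1, (V i x).2) <> (0, 0).
  by rewrite -surjective_pairing; exact: hV0.
have := nabla_sigma (fun k l => dg k l ix) (fun v => dphi v ix) (nfr ix)
  (da X ix) (dal X ix) Tphi N0.
rewrite (vec3_eta v) => /(_ (v (inord 0)) (v (inord 1)) (v (inord 2))).
rewrite (sigma_variationE _ _ _ c _ _ _ (pos ix) (ass ix) V0) -surjective_pairing => <-.
by congr (nabla_form _ _ x X _).
Qed.

Lemma is_torsion_sigma TV : is_torsion (sigma g vol V phi) TV <->
  forall i x X, ccod i x ->
    torsion_form g TV i x X =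
    oct_Im (oct_add (oct_Ad (g i x) (phi i x) (V i x) (torsion_form g T i x X))
      (oct_mul (g i x) (phi i x) (V i x) (nabla g (inv_section g V) i x X))).
Proof.
rewrite (is_torsionP TV sg sv sigma_frame_field).
split=> [H i x X ix|H i x X v ix]; last first.
  by rewrite nabla_sigma_field// -H.
rewrite /torsion_form /oct_of_tensor [RHS]/oct_Im; congr (_, _).
have [F frF] := sigma_frame_field ix.
apply: (is_frame_psi_inj frF) => u v w.
have := H i x X (vec3 u v w) ix; rewrite nabla_sigma_field//.
by move=> /mulfI -> //; rewrite pnatr_eq0.
Qed.

Lemma torsion_constant_norm_field i x X : constant_norm g V -> ccod i x ->
  oct_Im (oct_add (oct_Ad (g i x) (phi i x) (V i x) (torsion_form g T i x X))
    (oct_mul (g i x) (phi i x) (V i x) (nabla g (inv_section g V) i x X))) =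
  oct_opp (oct_mul (g i x) (phi i x) (octD phi g T V i x X)
    (oct_inv (g i x) (V i x))).
Proof.
move=> [c0 cN] ix; have [F frF] := fr ix.
have [c ->] := nabla_inv_section X ix.
have H1 := is_derive_oct_norm2 (fun k l => dg k l ix) (near_frame_sym (nfr ix))
  (near_frame_unit (nfr ix)) (da X ix) (dal X ix).
(* The squared norm is the constant c0^2 on the chart; comparing with the product rule in [H1] shows
   that V and its derivative are orthogonal. *)
have H2 : is_derive x X (fun y => oct_norm2 (g i y) ((V i y).1, (V i y).2)) 0.
  apply: near_eq_is_derive (is_derive_const x X (c0 ^+ 2)).
  near=> y; have iy : ccod i y by near: y; exact: near_chart.
  have [F' frF'] := fr iy.
  by rewrite -surjective_pairing -(cN i y iy) sqr_sqrtr// (oct_norm2_ge0 _ frF').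
have dN : (V i x).1 * (nabla g V i x X).1 +
    ip (g i x) (nabla g V i x X).2 (V i x).2 = 0.
  apply: (@mulfI _ 2); rewrite ?pnatr_eq0// mulr0 mulrDr mulrA.
  exact: (is_derive_unique H1 H2).
have := torsion_constant_norm (oct_of_tensor (g i x) (T i x) X).2 c frF dN.
by rewrite -surjective_pairing => ->.
Unshelve. all: by end_near. Qed.

End Sigma.

End TorsionFields.

Theorem theorem7p2 (R : realType) (M : manifold7 R)
  (phi : chart_field M (mform R 3)) (g : chart_field M 'M[R]_7) (vol : chart_field M (mform R 7))
  (T : chart_field M 'M[R]_7) (V : chart_field M (oct R))
  (hphi : G2_structure phi) (hg : associated_metric phi g vol)
  (hT0 : smooth_tensor2 T) (hT : is_torsion phi T)
  (hV : oct_section V) (hV0 : nowhere_vanishing V) :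
  (forall TV : chart_field M 'M[R]_7,
     is_torsion (sigma g vol V phi) TV <->
     forall i x X, ccod i x ->
       torsion_form g TV i x X =
       oct_Im (oct_add (oct_Ad (g i x) (phi i x) (V i x) (torsion_form g T i x X))
                 (oct_mul (g i x) (phi i x) (V i x)
                    (nabla g (inv_section g V) i x X)))) /\
  (constant_norm g V ->
   forall TV : chart_field M 'M[R]_7,
     is_torsion (sigma g vol V phi) TV <->
     forall i x X, ccod i x ->
       torsion_form g TV i x X =
       oct_opp (oct_mul (g i x) (phi i x) (octD phi g T V i x X)
                  (oct_inv (g i x) (V i x)))).
Proof.
have H := is_torsion_sigma hphi hg hT hV hV0; split => // cN TV.
have E i x X := @torsion_constant_norm_field R M phi g vol T V hphi hg hV hV0 i x X cN.
by rewrite H; split=> HT i x X ix; rewrite (HT i x X ix) (E i x X ix).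
Qed.
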